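(* There is an algorithm that, given a finite-state automaton $\mathcal{S}=(X,T,X_0,\to,\Sigma,\ell)$ and $k_1,k_2\in\mathbb{N}$, decides in polynomial time (polynomial in the size of $\mathcal{S}$ and in $k_1,k_2$) whether $\mathcal{S}$ is $\omega$-$(k_1,k_2)$-detectable.
   Context: A finite-state automaton (FSA) is a sextuple $\mathcal{S}=(X,T,X_0,\to,\Sigma,\ell)$, where $X$ is a finite set of states, $T$ a finite set of events, $X_0\subset X$ a set of initial states, $\to\subset X\times T\times X$ a transition relation, $\Sigma$ a finite set of labels, and $\ell:T\to\Sigma\cup\{\epsilon\}$ a labeling function ($\epsilon$ is the empty word). No further assumption (deadlock-freeness, absence of unobservable cycles, etc.) is made. $\ell$ is extended to finite and infinite event sequences by $\ell(t_1t_2\dots)=\ell(t_1)\ell(t_2)\dots$, $\ell(\epsilon)=\epsilon$. For $s=t_1\cdots t_n\in T^*$, $x\xrightarrow{s}x'$ means that there are states $x=x_0,x_1,\dots,x_n=x'$ with $(x_{i-1},t_i,x_i)\in\to$ for all $i$ (so $x\xrightarrow{\epsilon}x$). The size of $\mathcal{S}$ is e.g. $|X|+|T|+|\Sigma|+|\to|$. For $\sigma_1,\sigma_2\in\Sigma^*$ define the delayed state estimate $$\mathcal{M}(\mathcal{S},\sigma_1,\sigma_2)=\{x\in X\mid \exists x_0\in X_0,\ \exists x'\in X,\ \exists s_1,s_2\in T^*:\ \ell(s_1)=\sigma_1,\ \ell(s_2)=\sigma_2,\ x_0\xrightarrow{s_1}x\xrightarrow{s_2}x'\}.$$ The $\omega$-language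 $\mathcal{L}^\omega(\mathcal{S})$ is the set of $\sigma\in\Sigma^\omega$ (infinite words) such that $\sigma=\ell(t_1t_2\dots)$ for some infinite event sequence $t_1t_2\dots\in T^\omega$ for which there are states $x_0,x_1,\dots$ with $x_0\in X_0$ and $(x_i,t_{i+1},x_{i+1})\in\to$ for all $i\in\mathbb{N}$. Write $\sigma'\sqsubset\sigma$ if the finite word $\sigma'$ is a prefix of $\sigma$. $\mathcal{S}$ is $\omega$-$(k_1,k_2)$-detectable if for all $\sigma\in\mathcal{L}^\omega(\mathcal{S})$ and all $\sigma_1,\sigma_2\in\Sigma^*$ with $\sigma_1\sigma_2\sqsubset\sigma$: if $|\sigma_1|\ge k_1$ and $|\sigma_2|\ge k_2$, then $|\mathcal{M}(\mathcal{S},\sigma_1,\sigma_2)|=1$. *)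

(* Defs.v *)
From mathcomp Require Import all_boot all_order all_algebra.
From mathcomp Require Import boolp.

Set Implicit Arguments.
Unset Strict Implicit.
Unset Printing Implicit Defensive.

Record fsa := FSA {
  state : finType;
  event : finType;
  label : finType;
  init  : {set state};
  trans : {set state * event * state};
  (* [None] stands for the empty word *)
  lab   : event -> option label
}.

Definition fsa_size (S : fsa) : nat :=
  #|state S| + #|event S| + #|label S| + #|trans S|.

Definition labseq (S : fsa) (s : seq (event S)) : seq (label S) :=
  pmap (@lab S) s.

Fixpoint reaches (S : fsa) (x : state S) (s : seq (event S)) (x' : state S) :
    Prop :=
  match s with
  | [::] => x = x'
  | t :: s' => exists2 y, (x, t, y) \in trans S & reaches y s' x'
  end.

Definition delayed_estimate (S : fsa) (sigma1 sigma2 : seq (label S)) :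
    {set state S} :=
  [set x | `[< exists x0 x' s1 s2,
      [/\ x0 \in init S, labseq s1 = sigma1, labseq s2 = sigma2,
          reaches x0 s1 x & reaches x s2 x'] >] ].

Definition prefix_of (A : Type) (w : seq A) (sigma : nat -> A) : Prop :=
  mkseq sigma (size w) = w.

(* The label of an infinite event sequence may be a finite word; the second
   conjunct says that it is infinite, the first that it then equals sigma. *)
Definition omega_labseq (S : fsa) (u : nat -> event S)
    (sigma : nat -> label S) : Prop :=
  (forall n, prefix_of (labseq (mkseq u n)) sigma) /\
  (forall n, exists m, n <= size (labseq (mkseq u m))).

Definition omega_language (S : fsa) (sigma : nat -> label S) : Prop :=
  exists (u : nat -> event S) (x : nat -> state S),
    [/\ x 0 \in init S, forall i, (x i, u i, x i.+1) \in trans S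
      & omega_labseq u sigma].

Definition omega_detectable (S : fsa) (k1 k2 : nat) : Prop :=
  forall sigma : nat -> label S, omega_language sigma ->
  forall sigma1 sigma2 : seq (label S), prefix_of (sigma1 ++ sigma2) sigma ->
    k1 <= size sigma1 -> k2 <= size sigma2 ->
    #|delayed_estimate sigma1 sigma2| = 1.

(* Random access machine with a read-only input tape of natural numbers and
   natural-number registers, all initially 0; every instruction costs one
   step.  Arithmetic is limited to addition and truncated subtraction: without
   multiplication, a register has O(t + b) bits after t steps on inputs of
   b-bit numbers, so unit-cost time is polynomially equivalent to
   Turing-machine time. *)
Inductive instr :=
  | IConst of nat & nat
  | IRead  of nat & nat
  | IFetch of nat & nat
  | IStore of nat & nat
  | IAdd   of nat & nat & nat
  | ISub   of nat & nat & nat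
  | IJump  of nat
  | IJzero of nat & nat
  | IHalt  of bool.

Definition program := seq instr.

Definition upd (m : nat -> nat) (d v : nat) : nat -> nat :=
  fun i => if i == d then v else m i.

(* [None]: no answer within [fuel] steps; a program counter outside the
   program never gives an answer.  Input cells beyond the input read as 0. *)
Fixpoint run (P : program) (inp : seq nat) (fuel pc : nat) (m : nat -> nat) :
    option bool :=
  if fuel is f.+1 then
    match onth P pc with
    | None => None
    | Some (IConst d c) => run P inp f pc.+1 (upd m d c)
    | Some (IRead d a) => run P inp f pc.+1 (upd m d (nth 0 inp (m a)))
    | Some (IFetch d a) => run P inp f pc.+1 (upd m d (m (m a)))
    | Some (IStore a b) => run P inp f pc.+1 (upd m (m a) (m b))
    | Some (IAdd d a b) => run P inp f pc.+1 (upd m d (m a + m b))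
    | Some (ISub d a b) => run P inp f pc.+1 (upd m d (m a - m b))
    | Some (IJump l) => run P inp f l m
    | Some (IJzero a l) => run P inp f (if m a == 0 then l else pc.+1) m
    | Some (IHalt b) => Some b
    end
  else None.

Definition answers_within (P : program) (inp : seq nat) (t : nat) (b : bool) :
    Prop :=
  run P inp t 0 (fun=> 0) = Some b.

(* States, events and labels are numbered from 0 by [enum_rank]; a label
   function value is coded as 0 for the empty word and 1 + (number of the
   label) otherwise. *)
Definition encode (S : fsa) (k1 k2 : nat) : seq nat :=
  [:: #|state S|; #|event S|; #|label S|; #|init S|; #|trans S|; k1; k2]
  ++ [seq nat_of_ord (enum_rank x) | x <- enum (init S)]
  ++ [seq (if lab t is Some a then (nat_of_ord (enum_rank a)).+1 else 0)
     | t <- enum (event S)]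
  ++ flatten [seq [:: nat_of_ord (enum_rank e.1.1);
                      nat_of_ord (enum_rank e.1.2);
                      nat_of_ord (enum_rank e.2)] | e <- enum (trans S)].

(* Main.v *)
(**
Pair the automaton with itself, adding an idle unobservable move at every
state, and let both components read the same word.  A run of pairs that reads
at least k1 labels, then visits two distinct states, and then reads at least k2
more labels exhibits words sigma1, sigma2 with two states in the delayed
estimate.  These words are prefixes of an omega-word exactly when the first
component can still read infinitely many labels, and by the pigeonhole principle
this holds as soon as it can read |X| further ones.  Counting labels up to
k1 + k2 + 1 + |X| turns failure of detectability into reachability in a graph of
polynomial size, which is decided by saturating an array of marks.

The marking procedure is written in a language with bounded loops whose only
assignments are marks: all values, hence all running times, are then bounded by
polynomials in the largest input number.
*)
Require Import Defs.
From mathcomp Require Import all_boot all_order all_algebra.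
From mathcomp Require Import boolp zify.

Set Implicit Arguments.
Unset Strict Implicit.
Unset Printing Implicit Defensive.

(** * Evaluation of polynomials over the natural numbers *)

Lemma hornerD_nat (p q : {poly nat}) z : (p + q)%R.[z]%R = p.[z]%R + q.[z]%R.
Proof. exact: hornerD. Qed.

Lemma hornerM_nat (p q : {poly nat}) z : (p * q)%R.[z]%R = p.[z]%R * q.[z]%R.
Proof. exact: hornerM. Qed.

Lemma hornerC_nat (c z : nat) : (c%:P)%R.[z]%R = c.
Proof. exact: hornerC. Qed.

Lemma hornerX_nat (z : nat) : ('X : {poly nat})%R.[z]%R = z.
Proof. exact: hornerX. Qed.

Definition horner_natE := (hornerD_nat, hornerM_nat, hornerC_nat, hornerX_nat).

(** * A bounded-loop language and its compilation *)

Inductive expr :=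
  | EConst of nat
  | EVar of nat
  | EInp of expr
  | EMark of expr
  | EAdd of expr & expr
  | ESub of expr & expr
  | EMul of expr & expr.

(* Variables are de Bruijn levels: [EVar l] is the counter of the [l]-th
   enclosing loop, counted from the outermost. *)
Inductive cmd :=
  | CMark of expr
  | CSeq of cmd & cmd
  | CIf of expr & cmd
  | CFor of expr & cmd.

Fixpoint eval (inp env : seq nat) (a : pred nat) (e : expr) : nat :=
  match e with
  | EConst c => c
  | EVar l => nth 0 env l
  | EInp e1 => nth 0 inp (eval inp env a e1)
  | EMark e1 => a (eval inp env a e1)
  | EAdd e1 e2 => eval inp env a e1 + eval inp env a e2
  | ESub e1 e2 => eval inp env a e1 - eval inp env a e2
  | EMul e1 e2 => eval inp env a e1 * eval inp env a e2
  end.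

(** The limit of a loop is evaluated once, on entry, so that the body cannot prolong its own
    loop. *)
Fixpoint exec (inp env : seq nat) (c : cmd) (a : pred nat) : pred nat :=
  match c with
  | CMark e => predU (pred1 (eval inp env a e)) a
  | CSeq c1 c2 => exec inp env c2 (exec inp env c1 a)
  | CIf e c1 => if eval inp env a e == 0 then a else exec inp env c1 a
  | CFor e c1 =>
      iteri (eval inp env a e) (fun i => exec inp (rcons env i) c1) a
  end.

(* Even addresses form a stack of temporaries, odd addresses hold the marks. *)
Fixpoint compile_expr (o d : nat) (e : expr) : program :=
  match e with
  | EConst c => [:: IConst d.*2 c]
  | EVar l => [:: IConst d.*2 0; IAdd d.*2 l.*2.*2 d.*2]
  | EInp e1 => compile_expr o d e1 ++ [:: IRead d.*2 d.*2]
  | EMark e1 => compile_expr o d e1 ++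
      [:: IAdd d.*2 d.*2 d.*2; IConst d.+1.*2 1; IAdd d.*2 d.*2 d.+1.*2;
          IFetch d.*2 d.*2]
  | EAdd e1 e2 =>
      let p1 := compile_expr o d e1 in
      p1 ++ compile_expr (o + size p1) d.+1 e2 ++
      [:: IAdd d.*2 d.*2 d.+1.*2]
  | ESub e1 e2 =>
      let p1 := compile_expr o d e1 in
      p1 ++ compile_expr (o + size p1) d.+1 e2 ++
      [:: ISub d.*2 d.*2 d.+1.*2]
  | EMul e1 e2 =>
      let p1 := compile_expr o d.+1 e1 in
      let p2 := compile_expr (o + size p1) d.+2 e2 in
      let o' := o + size p1 + size p2 in
      p1 ++ p2 ++
      [:: IConst d.*2 0; IConst d.+3.*2 1; IJzero d.+2.*2 (o'.+2 + 4);
          IAdd d.*2 d.*2 d.+1.*2; ISub d.+2.*2 d.+2.*2 d.+3.*2;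
          IJump o'.+2]
  end.

(* At nesting depth [k] the counter and the limit of the [l]-th loop, [l < k],
   occupy the stack positions [2l] and [2l+1]. *)
Fixpoint compile (o k : nat) (c : cmd) : program :=
  match c with
  | CMark e => compile_expr o k.*2 e ++
      [:: IAdd k.*2.*2 k.*2.*2 k.*2.*2; IConst k.*2.+1.*2 1;
          IAdd k.*2.*2 k.*2.*2 k.*2.+1.*2; IStore k.*2.*2 k.*2.+1.*2]
  | CSeq c1 c2 =>
      let p1 := compile o k c1 in p1 ++ compile (o + size p1) k c2
  | CIf e c1 =>
      let p := compile_expr o k.*2 e in
      let p1 := compile (o + size p).+1 k c1 in
      p ++ IJzero k.*2.*2 ((o + size p).+1 + size p1) :: p1
  | CFor e c1 =>
      let p := compile_expr o k.*2.+1 e in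
      let o' := o + size p in
      let p1 := compile (o' + 3) k.+1 c1 in
      p ++ [:: IConst k.*2.*2 0; ISub k.*2.+2.*2 k.*2.+1.*2 k.*2.*2;
               IJzero k.*2.+2.*2 (o' + 6 + size p1)] ++
      p1 ++ [:: IConst k.*2.+2.*2 1; IAdd k.*2.*2 k.*2.*2 k.*2.+2.*2;
                IJump o'.+1]
  end.

(** * Polynomial bounds on values and running times *)

(** The indeterminate stands for a bound on the input numbers, and [benv] bounds the loop counters.
    Truncated subtraction never exceeds its first argument. *)
Fixpoint value_bound (benv : seq {poly nat}) (e : expr) : {poly nat} :=
  match e with
  | EConst c => (c%:P)%R
  | EVar l => nth 0%R benv l
  | EInp _ => 'X%R
  | EMark _ => (1%N%:P)%R
  | EAdd e1 e2 => (value_bound benv e1 + value_bound benv e2)%R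
  | ESub e1 _ => value_bound benv e1
  | EMul e1 e2 => (value_bound benv e1 * value_bound benv e2)%R
  end.

(** The constants count emitted instructions. A product runs a loop of four instructions as often as
    its second factor says, with two instructions before it and one last test. *)
Fixpoint expr_time (benv : seq {poly nat}) (e : expr) : {poly nat} :=
  match e with
  | EConst _ => (1%N%:P)%R
  | EVar _ => (2%N%:P)%R
  | EInp e1 => (expr_time benv e1 + 1%N%:P)%R
  | EMark e1 => (expr_time benv e1 + 4%N%:P)%R
  | EAdd e1 e2 | ESub e1 e2 =>
      (expr_time benv e1 + expr_time benv e2 + 1%N%:P)%R
  | EMul e1 e2 => (expr_time benv e1 + expr_time benv e2 + 3%N%:P
                   + value_bound benv e2 * 4%N%:P)%R
  end.

(** Of the 3 extra steps of a loop, one clears the counter and two perform the last test. The 5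
    steps per round are two for the test and three for the increment and the jump back. *)
Fixpoint cmd_time (benv : seq {poly nat}) (c : cmd) : {poly nat} :=
  match c with
  | CMark e => (expr_time benv e + 4%N%:P)%R
  | CSeq c1 c2 => (cmd_time benv c1 + cmd_time benv c2)%R
  | CIf e c1 => (expr_time benv e + 1%N%:P + cmd_time benv c1)%R
  | CFor e c1 => (expr_time benv e + 3%N%:P + value_bound benv e *
                  (cmd_time (rcons benv (value_bound benv e)) c1 + 5%N%:P))%R
  end.

Definition bounds (benv : seq {poly nat}) (z : nat) (env : seq nat) : Prop :=
  forall l, nth 0 env l <= (nth 0%R benv l).[z]%R.

Lemma bounds_rcons benv z env p i : size benv = size env ->
  bounds benv z env -> i <= p.[z]%R -> bounds (rcons benv p) z (rcons env i).
Proof.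
move=> eq_sz bnd le_ip l; rewrite !nth_rcons eq_sz.
by case: ltngtP => // _; apply: bnd.
Qed.

Lemma eval_bound inp benv z env a e : (forall i, nth 0 inp i <= z) ->
  bounds benv z env -> eval inp env a e <= (value_bound benv e).[z]%R.
Proof.
move=> inp_z bnd; elim: e
  => [c|l|e _|e _|e1 IH1 e2 IH2|e1 IH1 e2 IH2|e1 IH1 e2 IH2] /=;
  rewrite ?horner_natE //.
- by case: (a _).
- exact: leq_add.
- exact: leq_trans (leq_subr _ _) IH1.
- exact: leq_mul.
Qed.

(** * Composing runs of the machine *)

Definition mem := nat -> nat.

(** The equation holds for every remaining fuel [f], so that runs compose and their times add. *)
Definition runs (P : program) (inp : seq nat) (T pc : nat) (m : mem)
    (pc' : nat) (m' : mem) : Prop :=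
  exists2 t, t <= T & forall f, run P inp (t + f) pc m = run P inp f pc' m'.

Lemma runs0 P inp pc pc' m : pc = pc' -> runs P inp 0 pc m pc' m.
Proof. by move->; exists 0. Qed.

Lemma runs_trans P inp T1 T2 pc m pc1 m1 pc2 m2 :
  runs P inp T1 pc m pc1 m1 -> runs P inp T2 pc1 m1 pc2 m2 ->
  runs P inp (T1 + T2) pc m pc2 m2.
Proof.
case=> t1 le1 run1 [t2 le2 run2]; exists (t1 + t2); first exact: leq_add.
by move=> f; rewrite -addnA run1 run2.
Qed.

Lemma runsW P inp T1 T2 pc m pc1 m1 :
  T1 <= T2 -> runs P inp T1 pc m pc1 m1 -> runs P inp T2 pc m pc1 m1.
Proof. by move=> le12 [t le1 run1]; exists t => //; apply: leq_trans le12. Qed.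

Definition step (inp : seq nat) (i : instr) (pc : nat) (m : mem) : nat * mem :=
  match i with
  | IConst d c => (pc.+1, upd m d c)
  | IRead d a => (pc.+1, upd m d (nth 0 inp (m a)))
  | IFetch d a => (pc.+1, upd m d (m (m a)))
  | IStore a b => (pc.+1, upd m (m a) (m b))
  | IAdd d a b => (pc.+1, upd m d (m a + m b))
  | ISub d a b => (pc.+1, upd m d (m a - m b))
  | IJump l => (l, m)
  | IJzero a l => (if m a == 0 then l else pc.+1, m)
  | IHalt _ => (pc, m)
  end.

Lemma runs_step P inp i T pc m pc' m' :
  onth P pc = Some i -> (if i is IHalt _ then false else true) ->
  runs P inp T (step inp i pc m).1 (step inp i pc m).2 pc' m' ->
  runs P inp T.+1 pc m pc' m'.
Proof.
move=> Pi nhalt [t le_t run_t]; exists t.+1 => // f; rewrite addSn /= Pi.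
by case: i nhalt run_t {Pi}.
Qed.

Lemma run_mono P inp t t' pc m b : t <= t' ->
  run P inp t pc m = Some b -> run P inp t' pc m = Some b.
Proof.
elim: t t' pc m => [//|t IH] [//|t'] pc m /= le_t.
by case: (onth P pc) => // -[] *; auto.
Qed.

(** Jump targets are absolute: code is compiled for a fixed offset [o] and has to be found exactly
    there. *)
Definition code_at (P : program) (o : nat) (s : program) : Prop :=
  forall i, i < size s -> onth P (o + i) = onth s i.

Lemma code_at_cat P o s1 s2 : code_at P o (s1 ++ s2) ->
  code_at P o s1 /\ code_at P (o + size s1) s2.
Proof.
move=> cP; split=> i lt_i.
  by rewrite cP ?size_cat ?ltn_addr // onth_cat lt_i.
rewrite -addnA cP ?size_cat ?ltn_add2l // onth_cat.
by rewrite ltnNge leq_addr addKn.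
Qed.

Lemma code_at_cons P o i s : code_at P o (i :: s) ->
  onth P o = Some i /\ code_at P o.+1 s.
Proof.
move=> cP; split; first by have := cP 0 isT; rewrite addn0.
by move=> j lt_j; rewrite addSnnS cP.
Qed.

(* [m'] agrees with [m] outside the stack positions from [d] on. *)
Definition same_below (d : nat) (m m' : mem) : Prop :=
  forall x, odd x || (x < d.*2) -> m' x = m x.

Lemma same_below_trans d m1 m2 m3 : same_below d m1 m2 ->
  same_below d m2 m3 -> same_below d m1 m3.
Proof. by move=> s12 s23 x ltx; rewrite s23 // s12. Qed.

Lemma same_belowW d d' m m' : d <= d' ->
  same_below d' m m' -> same_below d m m'.
Proof. move=> led s x ltx; apply: s; lia. Qed.

Lemma upd_eq m d v : upd m d v d = v.
Proof. by rewrite /upd eqxx. Qed.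

Lemma upd_neq m d v x : x <> d -> upd m d v x = m x.
Proof. by rewrite /upd => /eqP/negPf ->. Qed.

Lemma same_below_upd d d' m m' v : d <= d' -> same_below d m m' ->
  same_below d m (upd m' d'.*2 v).
Proof. by move=> led s x ltx; rewrite upd_neq ?s //; lia. Qed.

(** Stack position [i] has address [2i] and the counter of loop [l] sits at position [2l], hence the
    address [4l]. *)
Definition represents (m : mem) (env : seq nat) (a : pred nat) : Prop :=
  (forall l, l < size env -> m l.*2.*2 = nth 0 env l) /\
  (forall i, m i.*2.+1 = a i).

Lemma represents_same d m m' env a : (size env).*2 <= d ->
  same_below d m m' -> represents m env a -> represents m' env a.
Proof.
move=> led s [menv ma]; split=> [l ltl|i].
  by rewrite s ?menv //; lia.
by rewrite s //; lia.
Qed.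

Ltac split_code := repeat match goal with
  | H : code_at _ _ (_ ++ _) |- _ => case/code_at_cat: H => ? ?
  | H : code_at _ _ (_ :: _) |- _ => case/code_at_cons: H => ? ?
  | H : code_at _ _ [::] |- _ => clear H
  end.

Ltac run_step := (apply: runs_step;
  [eassumption | done | rewrite /step ?[fst _]/= ?[snd _]/=]).

(** * Correctness of the compiler *)

Section Compiler.

Variables (P : program) (inp : seq nat) (z : nat).
Hypothesis inp_z : forall i, nth 0 inp i <= z.


(** Repeated addition: [d1] accumulates, [d3] counts down from [y], and [d4] holds the decrement
    1. *)
Lemma mul_loop L d1 d2 d3 d4 m x y : uniq [:: d1; d2; d3; d4] ->
  m d2 = x -> m d3 = y -> m d4 = 1 ->
  code_at P L [:: IJzero d3 (L + 4); IAdd d1 d1 d2; ISub d3 d3 d4; IJump L] ->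
  exists m', [/\ runs P inp (y * 4 + 1) L m (L + 4) m',
    m' d1 = m d1 + x * y & forall u, u != d1 -> u != d3 -> m' u = m u].
Proof.
rewrite /= !inE !negb_or -!andbA => /and5P[n12 n13 n14 n23 /and3P[n24 n34 _]].
move=> m2 m3 m4 cP; split_code.
elim: y => [|y IH] in m m2 m3 m4 *.
  exists m; split=> //; last by rewrite muln0 addn0.
  by do !run_step; rewrite m3; apply: runs0; lia.
set m1 := upd (upd m d1 (m d1 + m d2)) d3 (upd m d1 (m d1 + m d2) d3
             - upd m d1 (m d1 + m d2) d4).
have neq u : u != d1 -> u != d3 -> m1 u = m u.
  by move=> /eqP n1 /eqP n3; rewrite /m1 !upd_neq.
have [|||m' [run' e1 e']] := IH m1.
- by rewrite neq // eq_sym.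
- rewrite /m1 upd_eq !upd_neq ?m3 ?m4 ?subSS ?subn0 //; apply/eqP;
    by rewrite eq_sym.
- by rewrite neq // eq_sym.
exists m'; split.
- rewrite mulSn -addnA; do 4!(run_step; rewrite ?m3 //=); exact: run'.
- rewrite e1 /m1 upd_neq; last exact/eqP.
  by rewrite upd_eq m2 mulnS addnA.
- by move=> u n1 n3; rewrite e' // neq.
Qed.

(** Out of scope, a variable evaluates to 0, whereas the compiled code would read a cell that may
    hold a temporary. *)
Fixpoint scoped_expr (k : nat) (e : expr) : bool :=
  match e with
  | EConst _ => true
  | EVar l => l < k
  | EInp e1 | EMark e1 => scoped_expr k e1
  | EAdd e1 e2 | ESub e1 e2 | EMul e1 e2 => scoped_expr k e1 && scoped_expr k e2
  end.

Fixpoint scoped (k : nat) (c : cmd) : bool :=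
  match c with
  | CMark e => scoped_expr k e
  | CSeq c1 c2 => scoped k c1 && scoped k c2
  | CIf e c1 => scoped_expr k e && scoped k c1
  | CFor e c1 => scoped_expr k e && scoped k.+1 c1
  end.

(** Code for position [d] writes only stack positions from [d] on, so the first operand, the loop
    counters and the marks survive the evaluation of the second operand. *)
Lemma compile_expr_correct benv env a e o d m :
  bounds benv z env -> scoped_expr (size env) e -> (size env).*2 <= d ->
  represents m env a -> code_at P o (compile_expr o d e) ->
  exists m', [/\ runs P inp (expr_time benv e).[z]%R o m
                   (o + size (compile_expr o d e)) m',
    m' d.*2 = eval inp env a e & same_below d m m'].
Proof.
move=> bnd; elim: e o d m
  => [c|l|e IH|e IH|e1 IH1 e2 IH2|e1 IH1 e2 IH2|e1 IH1 e2 IH2] o d m /=;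
  rewrite ?horner_natE.
- move=> _ _ _ cP; split_code; eexists; split.
  + by run_step; apply: runs0; lia.
  + exact: upd_eq.
  + exact: same_below_upd.
- move=> ltl led [menv _] cP; split_code; eexists; split.
  + by do 2!run_step; apply: runs0; lia.
  + by rewrite upd_eq upd_eq addn0 upd_neq ?menv //; lia.
  + by do 2!apply: same_below_upd => //.
- move=> sc led rep cP; split_code.
  have [//|m1 [run1 e1 s1]] := IH o d m sc led rep; eexists; split.
  + apply: runs_trans run1 _; run_step.
    by apply: runs0; rewrite size_cat /=; lia.
  + by rewrite upd_eq e1.
  + exact: same_below_upd.
- move=> sc led rep cP; split_code.
  have [//|m1 [run1 e1 s1]] := IH o d m sc led rep.
  have [_ m1a] := represents_same led s1 rep.
  set v := eval inp env a e in e1 *; eexists; split.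
  + apply: runs_trans run1 _; do 4!run_step.
    by apply: runs0; rewrite size_cat /=; lia.
  (* [M] is the memory before the fetch: position [d] holds [2v + 1], the address of mark [v]. *)
  + rewrite upd_eq; set M := (M in M (M _)).
    have -> : M d.*2 = v.*2.+1.
      by rewrite /M !upd_eq upd_neq ?upd_eq ?e1; lia.
    by rewrite /M !upd_neq ?m1a //; lia.
  + by do 4!(apply: same_below_upd; first lia).
- move=> /andP[sc1 sc2] led rep cP; split_code.
  have [//|m1 [run1 e1' s1]] := IH1 o d m sc1 led rep.
  have [//|m2 [run2 e2' s2]] := IH2 (o + size (compile_expr o d e1)) d.+1 m1
    sc2 (leqW led) (represents_same led s1 rep).
  eexists; split.
  + apply: runs_trans (runs_trans run1 run2) _; run_step.
    by apply: runs0; rewrite !size_cat /=; lia.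
  + by rewrite upd_eq e2' s2 ?e1' //; lia.
  + apply: same_below_upd => //; apply: same_below_trans s1 _.
    exact: same_belowW s2.
- move=> /andP[sc1 sc2] led rep cP; split_code.
  have [//|m1 [run1 e1' s1]] := IH1 o d m sc1 led rep.
  have [//|m2 [run2 e2' s2]] := IH2 (o + size (compile_expr o d e1)) d.+1 m1
    sc2 (leqW led) (represents_same led s1 rep).
  eexists; split.
  + apply: runs_trans (runs_trans run1 run2) _; run_step.
    by apply: runs0; rewrite !size_cat /=; lia.
  + by rewrite upd_eq e2' s2 ?e1' //; lia.
  + apply: same_below_upd => //; apply: same_below_trans s1 _.
    exact: same_belowW s2.
- move=> /andP[sc1 sc2] led rep /code_at_cat[cP1 /code_at_cat[cP2]].
  case/code_at_cons=> i1 /code_at_cons[i2 cP3].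
  have le1 := leqW led; have le2 := leqW le1.
  have [//|m1 [run1 e1' s1]] := IH1 o d.+1 m sc1 le1 rep.
  have [//|m2 [run2 e2' s2]] :=
    IH2 (o + size (compile_expr o d.+1 e1)) d.+2 m1 sc2 le2
        (represents_same le1 s1 rep).
  set o2 := o + _ + _ in run2 *.
  set x := eval inp env a e1 in e1' *; set y := eval inp env a e2 in e2' *.
  pose m3 := upd (upd m2 d.*2 0) d.+3.*2 1.
  have [|||||m4 [run4 e4 s4]] := @mul_loop o2.+2 d.*2 d.+1.*2 d.+2.*2 d.+3.*2
    m3 x y.
  + by rewrite /= !inE; lia.
  + by rewrite /m3 !upd_neq ?s2 //; lia.
  + by rewrite /m3 !upd_neq //; lia.
  + exact: upd_eq.
  + exact: cP3.
  exists m4; split.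
  + have le_y : y <= (value_bound benv e2).[z]%R by apply: eval_bound.
    apply: runsW (runs_trans (runs_trans run1 run2)
                  (_ : runs P inp (2 + (y * 4 + 1)) _ _ _ _)); first by lia.
    do 2!run_step; rewrite !size_cat /=.
    have -> : o + (size (compile_expr o d.+1 e1) + (size (compile_expr (o + size
      (compile_expr o d.+1 e1)) d.+2 e2) + 6)) = o2.+2 + 4 by rewrite /o2; lia.
    exact: run4.
  + by rewrite e4 /m3 upd_neq ?upd_eq //; lia.
  + move=> u ltu; rewrite s4; try lia.
    by rewrite /m3 !upd_neq ?s2 ?s1 //; lia.
Qed.

(** The last conjunct is restricted to even addresses because marks do change. Applied to a loop
    body, one level deeper, it protects the counter and the limit of that loop. *)
Lemma compile_correct benv env c a o m :
  size benv = size env -> bounds benv z env -> scoped (size env) c ->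
  represents m env a -> code_at P o (compile o (size env) c) ->
  exists m', [/\ runs P inp (cmd_time benv c).[z]%R o m
                   (o + size (compile o (size env) c)) m',
    represents m' env (exec inp env c a) &
    forall x, x < (size env).*2 -> m' x.*2 = m x.*2].
Proof.
elim: c => [e|c1 IH1 c2 IH2|e c1 IH|e c1 IH] in benv env a o m *;
  rewrite /= ?horner_natE => eq_sz bnd.
- move=> sc rep /code_at_cat[cP1 cP2]; split_code.
  have [m1 [run1 e1 s1]] := compile_expr_correct bnd sc (leqnn _) rep cP1.
  have [m1env m1a] := represents_same (leqnn _) s1 rep.
  set v := eval inp env a e in e1 *; set d := (size env).*2 in s1 e1 *.
  pose M1 := upd (upd m1 d.*2 (m1 d.*2 + m1 d.*2)) d.+1.*2 1.
  (* The 1 in position [d.+1] serves twice: as the increment that makes the address odd and as the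
     value stored there. *)
  pose M := upd M1 d.*2 (M1 d.*2 + M1 d.+1.*2).
  have Md : M d.*2 = v.*2.+1.
    by rewrite /M /M1 !upd_eq upd_neq ?upd_eq ?e1; lia.
  have Md1 : M d.+1.*2 = 1 by rewrite /M upd_neq /M1 ?upd_eq //; lia.
  have sM x : odd x || (x < d.*2) -> M x = m1 x.
    by move=> ltx; rewrite /M /M1 !upd_neq //; lia.
  exists (upd M (M d.*2) (M d.+1.*2)); split.
  + rewrite size_cat addnA; apply: runs_trans run1 _.
    by do 4!run_step; apply: runs0; rewrite /= -/d; lia.
  + rewrite Md Md1; split=> [l ltl|i].
      by rewrite upd_neq ?sM ?m1env //; lia.
    rewrite /= /upd; case: eqP => [[/double_inj->]|ne]; first by rewrite eqxx.
    rewrite sM ?m1a //=; last by rewrite odd_double.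
    by case: eqP => // eq_iv; case: ne; rewrite eq_iv.
  + by move=> x ltx; rewrite Md upd_neq ?sM ?s1 //; lia.
- move=> /andP[sc1 sc2] rep /code_at_cat[cP1 cP2].
  have [m1 [run1 rep1 s1]] := IH1 _ _ _ _ _ eq_sz bnd sc1 rep cP1.
  have [m2 [run2 rep2 s2]] := IH2 _ _ _ _ _ eq_sz bnd sc2 rep1 cP2.
  exists m2; split=> //; last by move=> x ltx; rewrite s2 ?s1.
  by rewrite size_cat addnA; apply: runs_trans run1 run2.
- move=> /andP[sc1 sc2] rep /code_at_cat[cP1 /code_at_cons[i1 cP2]].
  have [m1 [run1 e1 s1]] := compile_expr_correct bnd sc1 (leqnn _) rep cP1.
  have rep1 := represents_same (leqnn _) s1 rep.
  rewrite size_cat /=; case: eqP => [ev0|/eqP evn0].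
    exists m1; split=> //; last by move=> x ltx; rewrite s1 //; lia.
    apply: runsW (leq_addr _ _) _; apply: runs_trans run1 _; run_step.
    by rewrite e1 ev0 /=; apply: runs0; lia.
  have [m2 [run2 rep2 s2]] := IH _ _ _ _ _ eq_sz bnd sc2 rep1 cP2.
  exists m2; split=> //; last by move=> x ltx; rewrite s2 // s1 //; lia.
  rewrite -addnA; apply: runs_trans run1 _; run_step.
  by rewrite e1 (negPf evn0) addnA addnS -addSn.
- move=> /andP[sc1 sc2] rep; set d := (size env).*2 => /code_at_cat[cP1].
  set o' := o + _; set p1 := compile (o' + 3) _ c1.
  case/code_at_cons=> i1 /code_at_cons[i2 /code_at_cons[i3 /code_at_cat[cP2]]].
  case/code_at_cons=> i4 /code_at_cons[i5 /code_at_cons[i6 _]].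
  set L := eval inp env a e.
  have [m1 [run1 e1 s1]] := compile_expr_correct bnd sc1 (leqnSn _) rep cP1.
  have rep1 := represents_same (leqnSn _) s1 rep.
  rewrite -/L in e1; set body := fun i => exec inp (rcons env i) c1.
  set T := (cmd_time _ c1).[z]%R.
  have le_L : L <= (value_bound benv e).[z]%R by apply: eval_bound.
  (* Induction on the number [j] of rounds still to run, [i] being the number of rounds done. *)
  suff loop j i mm : i + j = L -> mm d.*2 = i -> mm d.+1.*2 = L ->
      represents mm env (iteri i body a) ->
      exists m',
      [/\ runs P inp (j * (T + 5) + 2) o'.+1 mm (o' + 6 + size p1) m',
        represents m' env (iteri L body a) &
        forall x, x < d -> m' x.*2 = mm x.*2].
    have [|||//|m' [run' rep' s']] := loop L 0 (upd m1 d.*2 0).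
    + by [].
    + exact: upd_eq.
    + by rewrite upd_neq //; lia.
    + by apply: represents_same rep1; [exact: leqnn|exact: same_below_upd].
    exists m'; split=> //; last first.
      by move=> x ltx; rewrite s' // upd_neq ?s1 //; lia.
    apply: (@runsW _ _ ((expr_time benv e).[z]%R + (L * (T + 5) + 2).+1)).
      by have := leq_mul le_L (leqnn (T + 5)); lia.
    apply: runs_trans run1 _; run_step; rewrite !size_cat /= size_cat /=.
    by have -> : o + (size (compile_expr o d.+1 e) + (size p1 + 3).+3)
      = o' + 6 + size p1 by rewrite /o'; lia.
elim: j i mm => [|j IHj] i mm eq_ij mmd mmL repm.
  rewrite addn0 in eq_ij.
  exists (upd mm d.+2.*2 (mm d.+1.*2 - mm d.*2)); split.
  + do 2!run_step; rewrite upd_eq mmL mmd eq_ij subnn /=; apply: runs0; lia.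
  + rewrite -eq_ij; apply: represents_same repm; first exact: leqnn.
    by apply: same_below_upd => //; lia.
  + by move=> x ltx; rewrite upd_neq //; lia.
set mm1 := upd mm d.+2.*2 (mm d.+1.*2 - mm d.*2).
have rep1' : represents mm1 (rcons env i) (iteri i body a).
  have [menv ma] := repm.
  split=> [l|x]; last by rewrite /mm1 upd_neq ?ma //; lia.
  rewrite size_rcons nth_rcons ltnS leq_eqVlt => /predU1P[->|ltl].
    by rewrite ltnn eqxx /mm1 upd_neq //; lia.
  by rewrite ltl /mm1 upd_neq ?menv //; lia.
have lt_iL : i < L by lia.
have [||||m2] := IH (rcons benv (value_bound benv e)) (rcons env i)
  (iteri i body a) (o' + 3) mm1 _ _ _ rep1'.
- by rewrite !size_rcons eq_sz.
- by apply: bounds_rcons => //; apply: leq_trans (ltnW lt_iL) le_L.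
- by rewrite size_rcons.
- by rewrite size_rcons -/p1; rewrite addn3.
rewrite size_rcons -/p1 -/T => -[run2 rep2 s2].
pose m3 := upd m2 d.+2.*2 1.
pose m4 := upd m3 d.*2 (m3 d.*2 + m3 d.+2.*2).
have m2d : m2 d.*2 = i by rewrite s2 /mm1 ?upd_neq //; lia.
have m2L : m2 d.+1.*2 = L by rewrite s2 /mm1 ?upd_neq //; lia.
have m4d : m4 d.*2 = i.+1.
  by rewrite /m4 upd_eq /m3 upd_eq upd_neq ?m2d ?addn1 //; lia.
have m4L : m4 d.+1.*2 = L.
  by rewrite /m4 /m3 !upd_neq //; lia.
have rep4 : represents m4 env (iteri i.+1 body a).
  apply: (@represents_same d m2) => //.
  + by do 2!(apply: same_below_upd; first by lia).
  + have [menv ma] := rep2; split=> // l ltl.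
    by rewrite menv ?size_rcons ?nth_rcons ?ltl //; apply: leqW.
have [|//|//|//|m5 [run5 rep5 s5]] := IHj i.+1 m4; first by lia.
exists m5; split=> //; last first.
  move=> x ltx; rewrite s5 // /m4 /m3 !upd_neq ?s2 /mm1 ?upd_neq //; lia.
(* Two steps for the test, the body, three steps for increment and jump, then the remaining
   rounds. *)
apply: (@runsW _ _ (2 + (T + (3 + (j * (T + 5) + 2))))); first by lia.
do 2!run_step; rewrite upd_eq.
have -> : (mm d.+1.*2 - mm d.*2 == 0) = false by lia.
rewrite addn3 in run2; apply: runs_trans run2 _.
by do 3!run_step; exact: run5.
Qed.

End Compiler.

(** * From a marking procedure to a decision program *)

(** When [e] evaluates to 0 the test jumps over [IHalt false], so this is the accepting case. *)
Definition decider (c : cmd) (e : expr) : program :=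
  let p1 := compile 0 0 c in
  let p2 := compile_expr (size p1) 0 e in
  p1 ++ p2 ++ [:: IJzero 0 (size p1 + size p2 + 2); IHalt false; IHalt true].

Definition decider_time (c : cmd) (e : expr) : {poly nat} :=
  (cmd_time [::] c + expr_time [::] e + 2%N%:P)%R.

Lemma decider_correct c e inp z : scoped 0 c -> scoped_expr 0 e ->
  (forall i, nth 0 inp i <= z) ->
  answers_within (decider c e) inp (decider_time c e).[z]%R
    (eval inp [::] (exec inp [::] c pred0) e == 0).
Proof.
move=> sc se inp_z.
set p1 := compile 0 0 c; set p2 := compile_expr (size p1) 0 e.
have /code_at_cat[cP1 /code_at_cat[cP2]] :
    code_at (decider c e) 0 (decider c e).
  by move=> i _; rewrite add0n.
case/code_at_cons=> i1 /code_at_cons[i2 /code_at_cons[i3 _]].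
have bnd : bounds [::] z [::] by move=> l; rewrite !nth_nil.
have rep0 : represents (fun=> 0) [::] pred0 by split=> // i; case: (_ i).
have [m1 [run1 rep1 _]] :=
  @compile_correct _ _ _ inp_z [::] [::] _ _ _ _ erefl bnd sc rep0 cP1.
have [m2 [run2 e2 _]] :=
  @compile_expr_correct _ _ _ inp_z [::] [::] _ _ _ 0 _ bnd se isT rep1 cP2.
have [t le_t run_t] := runs_trans run1 run2.
rewrite /answers_within.
apply: (@run_mono _ _ (t + 2)); first by rewrite !horner_natE leq_add2r.
rewrite run_t /= i1 e2; case: eqP => _; last by rewrite i2.
by rewrite addn2 i3.
Qed.

(** * Reasoning about loops that only add marks *)

Section Exec.

Variable inp : seq nat.
Implicit Types (env : seq nat) (a : pred nat) (c : cmd) (e : expr).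

Lemma exec_sub env c a v : a v -> exec inp env c a v.
Proof.
elim: c env a => [e|c1 IH1 c2 IH2|e c IH|e c IH] env a av /=.
- by rewrite av orbT.
- by apply: IH2; apply: IH1.
- by case: ifP => // _; apply: IH.
- by elim: (eval _ _ _ _) => [|L IHL] //=; apply: IH.
Qed.

Lemma exec_for_sound (R : nat -> Prop) env e c a :
  (forall i a', i < eval inp env a e -> (forall v, a' v -> R v) ->
     forall v, exec inp (rcons env i) c a' v -> R v) ->
  (forall v, a v -> R v) -> forall v, exec inp env (CFor e c) a v -> R v.
Proof.
move=> sound aR; rewrite /=; move: (leqnn (eval inp env a e)).
elim: {1 3}(eval inp env a e) => [|L IH] //= lt_L.
by apply: (sound _ _ lt_L); apply: IH (ltnW lt_L).
Qed.

(** One good round suffices, as marks are never erased. The marks present when round [i] begins are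
    only known to include [a], so the body must succeed from any such set. *)
Lemma exec_for_hit env e c a i v : i < eval inp env a e ->
  (forall a', (forall w, a w -> a' w) -> exec inp (rcons env i) c a' v) ->
  exec inp env (CFor e c) a v.
Proof.
move=> lt_i hit /=; elim: (eval inp env a e) lt_i => [|L IH] //=.
rewrite ltnS leq_eqVlt => /predU1P[eq_i|/IH]; last exact: exec_sub.
rewrite -eq_i; apply: hit => w aw.
by elim: (i) => //= j IHj; apply: exec_sub.
Qed.

(** A path can be taken without repetitions and then has fewer than [#|T|] edges; each round follows
    one more of them. *)
Lemma exec_for_connect (T : finType) (r : rel T) (f : T -> nat) env e c a u v :
  #|T| <= eval inp env a e ->
  (forall i a' u' v', r u' v' -> a' (f u') ->
     exec inp (rcons env i) c a' (f v')) ->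
  connect r u v -> a (f u) -> exec inp env (CFor e c) a (f v).
Proof.
move=> le_T hit /connectP[p /shortenP[p' r_p' uniq_p' _] ->] au /=.
have {uniq_p'} lt_p' : size p' <= eval inp env a e.
  apply/ltnW/leq_trans/le_T; rewrite -[(size p').+1]/(size (u :: p')).
  by rewrite -(card_uniqP uniq_p') max_card.
elim: (eval inp env a e) p' lt_p' r_p' => [|L IH] p'; first by case: p'.
case/lastP: p' => [|p' w] /=.
  move=> _ _; apply: exec_sub; exact: (IH [::]).
rewrite size_rcons rcons_path last_rcons ltnS => le_L /andP[/(IH _ le_L) aL rw].
exact: hit rw aL.
Qed.

End Exec.

(** * Infinite runs *)

(** Rising by at most one at a time, [f] skips no value on its way up. It will be applied to the
    number of labels read. *)
Lemma discrete_ivt (f : nat -> nat) N v : (forall i, f i.+1 <= (f i).+1) ->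
  f 0 <= v <= f N -> exists2 i, i <= N & f i = v.
Proof.
move=> f_step /andP[f0]; elim: N => [fN|N IH fN].
  by exists 0 => //; apply/eqP; rewrite eqn_leq f0.
case: (leqP v (f N)) => [/IH[i le_i <-]|lt_v].
  by exists i => //; apply: leqW.
by exists N.+1 => //; apply/eqP; rewrite eqn_leq fN (leq_trans (f_step N)).
Qed.

Section Runs.

Variable S : fsa.
Implicit Types (x y : state S) (s : seq (event S)).
Implicit Types (us : nat -> event S) (xs : nat -> state S).

Lemma labseq_cat s1 s2 : labseq (s1 ++ s2) = labseq s1 ++ labseq s2.
Proof. exact: pmap_cat. Qed.

Lemma reaches_cat x s1 y s2 z :
  reaches x s1 y -> reaches y s2 z -> reaches x (s1 ++ s2) z.
Proof.
elim: s1 x => [|t s1 IH] x /= => [-> //|[x1 tx r1] r2].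
by exists x1 => //; apply: IH.
Qed.

Lemma reaches_states t0 x s x' : reaches x s x' ->
  exists xs : nat -> state S, [/\ xs 0 = x, xs (size s) = x' &
    forall i, i < size s -> (xs i, nth t0 s i, xs i.+1) \in trans S].
Proof.
elim: s x => [|t s IH] x /=; first by move=> <-; exists (fun=> x).
case=> y ty /IH[xs [xs0 xsN xsP]].
by exists (fun i => if i is j.+1 then xs j else x); split=> // -[|i] /=;
  [rewrite xs0 | apply: xsP].
Qed.

Definition run_upto (us : nat -> event S) (xs : nat -> state S) (n : nat) :=
  forall i, i < n -> (xs i, us i, xs i.+1) \in trans S.

Lemma run_reaches us xs n j l : run_upto us xs n -> j + l <= n ->
  reaches (xs j) [seq us i | i <- iota j l] (xs (j + l)).
Proof.
move=> run; elim: l j => [|l IH] j /= le_n; first by rewrite addn0.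
exists (xs j.+1); first by apply: run; lia.
by rewrite -addSnnS; apply: IH; lia.
Qed.

Definition lcount (us : nat -> event S) n := size (labseq (mkseq us n)).

Lemma lcountS us n : lcount us n.+1 = lcount us n + isSome (lab (us n)).
Proof.
rewrite /lcount mkseqS -cats1 labseq_cat size_cat /labseq /=.
by case: (lab _).
Qed.

Lemma labseq_mkseq_split us m n : m <= n ->
  labseq (mkseq us n) =
    labseq (mkseq us m) ++ labseq [seq us i | i <- iota m (n - m)].
Proof.
by move=> le_mn; rewrite -labseq_cat -map_cat -iotaD subnKC.
Qed.

Lemma lcount_mono us m n : m <= n -> lcount us m <= lcount us n.
Proof.
by move=> /(labseq_mkseq_split us) e; rewrite /lcount e size_cat leq_addr.
Qed.

Lemma lcount_ltP us a b : lcount us a < lcount us b ->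
  exists2 i, a <= i < b & isSome (lab (us i)).
Proof.
elim: b => [|b IH]; first by rewrite ltnNge lcount_mono.
rewrite lcountS; case e: (isSome _); last first.
  rewrite addn0 => /IH[i /andP[le_a lt_b] li].
  by exists i; rewrite // le_a ltnW.
move=> lt_ab; exists b => //; rewrite ltnSn andbT leqNgt; apply/negP => lt_ba.
have := lcount_mono us lt_ba; rewrite lcountS e; lia.
Qed.

Lemma nth_labseq_mkseq l0 us m n i : i < lcount us m -> i < lcount us n ->
  nth l0 (labseq (mkseq us m)) i = nth l0 (labseq (mkseq us n)) i.
Proof.
wlog le_mn : m n / m <= n.
  by move=> W im inn; case/orP: (leq_total m n) => le; [|symmetry]; apply: W.
by move=> im _; rewrite (labseq_mkseq_split us le_mn) nth_cat im.
Qed.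

(** The letter at index [n] is read off any prefix with more than [n] labels; by [nth_labseq_mkseq]
    the choice of the prefix does not matter. *)
Lemma omega_labseq_exists us : (forall n, exists m, n <= lcount us m) ->
  exists sigma, omega_labseq us sigma.
Proof.
move=> unb; have [l0 _] : exists l : label S, True.
  have [m] := unb 1; rewrite /lcount.
  by case: (labseq _) => // l; exists l.
have [M MP] := choice (fun n => unb n.+1).
exists (fun n => nth l0 (labseq (mkseq us (M n))) n); split=> // m.
apply: (@eq_from_nth _ l0); rewrite size_mkseq // => i lt_i.
by rewrite nth_mkseq //; apply: nth_labseq_mkseq.
Qed.

(** Going round the loop from [a] to [b] forever gives an infinite run, in which the labelled event
    at [i0] recurs, so that its word is infinite. *)
Lemma lasso us xs a b i0 : xs 0 \in init S -> run_upto us xs b ->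
  xs a = xs b -> a <= i0 < b -> isSome (lab (us i0)) ->
  exists2 sigma, omega_language sigma &
    forall j, j <= b -> prefix_of (labseq (mkseq us j)) sigma.
Proof.
move=> xs0 run eq_ab /andP[le_a lt_b] lab0.
(* [phi] maps time to a position in the finite run, returning to [a] instead of reaching [b]. *)
pose phi n := iter n (fun i => if i.+1 == b then a else i.+1) 0.
have phiS i : phi i.+1 = if (phi i).+1 == b then a else (phi i).+1 by [].
have phi_lt i : phi i < b.
  elim: i => [|i IH]; first by rewrite /phi /=; lia.
  by rewrite phiS; case: eqP => ?; lia.
have phi_add i k : phi i + k < b -> phi (i + k) = phi i + k.
  elim: k => [|k IH] lt_k; first by rewrite !addn0.
  rewrite addnS phiS IH; last by lia.
  by case: eqP; lia.
have phi_id i : i < b -> phi i = i by move=> ltb; apply: (phi_add 0).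
have phi_a i : phi (i + (b - phi i)) = a.
  have := phi_lt i => lt; have -> : b - phi i = (b - (phi i).+1).+1 by lia.
  by rewrite addnS phiS phi_add; [case: eqP; lia|lia].
pose u i := us (phi i); pose x i := xs (phi i).
have often n : exists2 i, n <= i & isSome (lab (u i)).
  (* From time [n], go on to the next visit of [a] and from there to [i0]. *)
  exists (n + (b - phi n) + (i0 - a)); first by lia.
  by rewrite /u phi_add phi_a ?subnKC.
have unb n : exists m, n <= lcount u m.
  elim: n => [|n [m IH]]; first by exists 0.
  have [i le_i li] := often m; exists i.+1; rewrite lcountS li addn1 ltnS.
  exact: leq_trans IH (lcount_mono _ le_i).
have [sigma sigP] := omega_labseq_exists unb; exists sigma.
  exists u, x; split=> // i; rewrite /x /u phiS.
  by case: eqP => [eb|_]; [rewrite eq_ab -eb|]; apply: run.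
move=> j le_j; have [pre _] := sigP; suff -> : mkseq us j = mkseq u j by [].
apply/eq_in_map => i; rewrite mem_iota add0n => lt_i.
by rewrite /u phi_id //; lia.
Qed.

(** Pigeonhole on [#|state S|.+1] positions, one for each count of labels from the count at [m] on.
    Two of them carry the same state, and since their counts differ a label is read in between,
    which gives a lasso. *)
Lemma pumping us xs m n : xs 0 \in init S -> run_upto us xs n ->
  lcount us m + #|state S| <= lcount us n ->
  exists2 sigma, omega_language sigma &
    prefix_of (labseq (mkseq us m)) sigma.
Proof.
move=> xs0 run le_cnt.
have pos (q : 'I_#|state S|.+1) :
    exists i, (i <= n) && (lcount us i == lcount us m + q).
  have [i||i le_i e] := @discrete_ivt (lcount us) n (lcount us m + q).
  - by rewrite lcountS; case: (isSome _); lia.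
  - rewrite (_ : lcount us 0 = 0) //=; apply: leq_trans le_cnt.
    by rewrite leq_add2l -ltnS.
  - by exists i; rewrite le_i e eqxx.
pose pos_of q := xchoose (pos q).
have posP q : pos_of q <= n /\ lcount us (pos_of q) = lcount us m + q.
  by have /andP[? /eqP] := xchooseP (pos q).
have /injectivePn[q [q' ne_qq' eq_x]] : ~~ injectiveb (xs \o pos_of).
  apply/negP => /injectiveP /leq_card; rewrite card_ord; lia.
wlog lt_q : q q' ne_qq' eq_x / q < q'.
  move=> W; case: (ltngtP q q') => [|lt|/val_inj e]; first exact: W.
    by apply: W lt => //; rewrite eq_sym.
  by rewrite e eqxx in ne_qq'.
have [le_n e] := posP q; have [le_n' e'] := posP q'.
have [|i i_ab li] := @lcount_ltP us (pos_of q) (pos_of q').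
  by rewrite e e' ltn_add2l.
have run' : run_upto us xs (pos_of q').
  by move=> j ltj; apply: run; apply: leq_trans le_n'.
have [sigma sL pre] := lasso xs0 run' eq_x i_ab li.
(* The count at the later position exceeds that at [m], so this position is not before [m] and the
   lasso keeps the first [m] events. *)
exists sigma => //; apply: pre; rewrite leqNgt; apply/negP => lt.
have := lcount_mono us (ltnW lt); lia.
Qed.

End Runs.

(** * Detectability as reachability *)

Section Product.

Variables (S : fsa) (k1 k2 : nat).
Implicit Types (x y z w : state S) (s : seq (event S)) (a b : option (label S)).

(** A list, with transitions before idle moves, because the marking procedure addresses moves by
    index. Idling lets one component perform an unobservable event alone. *)
Definition moves : seq (state S * option (label S) * state S) :=
  [seq (e.1.1, lab e.1.2, e.2) | e <- enum (trans S)] ++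
  [seq (x, None, x) | x : state S].

Lemma move_idle x : (x, None, x) \in moves.
Proof.
by rewrite mem_cat; apply/orP; right; apply/mapP; exists x; rewrite ?mem_enum.
Qed.

Lemma move_trans x t x' : (x, t, x') \in trans S -> (x, lab t, x') \in moves.
Proof.
move=> tr; rewrite mem_cat; apply/orP; left.
by apply/mapP; exists (x, t, x'); rewrite ?mem_enum.
Qed.

Lemma move_reaches x a x' : (x, a, x') \in moves ->
  exists2 s, reaches x s x' & labseq s = seq_of_opt a.
Proof.
rewrite mem_cat => /orP[] /mapP[].
  case=> [[x1 t] x2] /=; rewrite mem_enum => tr [-> -> ->].
  by exists [:: t]; [exists x2|rewrite /labseq /=; case: (lab t)].
by move=> x1 _ [-> -> ->]; exists [::].
Qed.

(** The 1 is the step out of level [k1], where the two states must differ; the last [#|state S|]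
    levels count the labels required by [pumping]. *)
Definition depth := (k1 + k2 + 1 + #|state S|)%N.

(* The second component follows the observation of the first one up to level
   [k1 + k2]; above, it moves freely.  A level may lag behind the number of
   labels read, and level [k1] is left only from two distinct states. *)
Inductive level_reach : nat -> state S -> state S -> Prop :=
  | LevelInit x y : x \in init S -> y \in init S -> level_reach 0 x y
  | LevelMove c x y a b x' y' c' : level_reach c x y -> c < depth ->
      (x, a, x') \in moves -> (y, b, y') \in moves ->
      (a == b) || (k1 + k2 < c) ->
      (c' == c) ||
      (c' == c.+1) && (if c == k1 then x != y else a != None) ->
      level_reach c' x' y'.

(** * The words witnessed by a level *)

Definition matched q x y x' y' : Prop :=
  exists s s', [/\ reaches x s x', reaches y s' y', labseq s = labseq s' &
    q <= size (labseq s)].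

Lemma matched_move q x y x1 y1 a x2 y2 : matched q x y x1 y1 ->
  (x1, a, x2) \in moves -> (y1, a, y2) \in moves ->
  matched (q + isSome a) x y x2 y2.
Proof.
case=> s [s' [rs rs' ls le_q]] /move_reaches[r rr lr] /move_reaches[r' rr' lr'].
exists (s ++ r), (s' ++ r'); split.
- exact: reaches_cat rs rr.
- exact: reaches_cat rs' rr'.
- by rewrite !labseq_cat ls lr lr'.
- by rewrite labseq_cat size_cat lr; case: a {lr lr'} => *; apply: leq_add.
Qed.

Lemma matchedW q q' x y x' y' : q <= q' ->
  matched q' x y x' y' -> matched q x y x' y'.
Proof.
move=> le_q [s [s' [? ? ? le_q']]]; exists s, s'; split=> //.
exact: leq_trans le_q'.
Qed.

Definition phase1 q z w : Prop :=
  exists x0 y0, [/\ x0 \in init S, y0 \in init S & matched q x0 y0 z w].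

Definition phase2 q x y : Prop :=
  exists z w, [/\ z != w, phase1 k1 z w & matched q z w x y].

(** The second component is dropped: after the two words it only matters how long the first one can
    read on. *)
Definition phase3 q x : Prop :=
  exists x1 y1 s, [/\ phase2 k2 x1 y1, reaches x1 s x & q <= size (labseq s)].

(** Counting starts anew at levels [k1 + 1] and [k1 + k2 + 1]; the offset 1 is the step out of level
    [k1], which may read no label. *)
Definition level_spec c x y : Prop :=
  if c <= k1 then phase1 c x y
  else if c <= k1 + k2 then phase2 (c - k1.+1) x y
  else phase3 (c - (k1 + k2).+1) x.

Lemma phase1_move q q' x y a x' y' : phase1 q x y ->
  (x, a, x') \in moves -> (y, a, y') \in moves -> q' <= q + isSome a ->
  phase1 q' x' y'.
Proof.
move=> [x0 [y0 [ix iy m]]] mx my le_q'; exists x0, y0; split=> //.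
exact: matchedW le_q' (matched_move m mx my).
Qed.

Lemma phase2_move q q' x y a x' y' : phase2 q x y ->
  (x, a, x') \in moves -> (y, a, y') \in moves -> q' <= q + isSome a ->
  phase2 q' x' y'.
Proof.
move=> [z [w [ne p1 m]]] mx my le_q'; exists z, w; split=> //.
exact: matchedW le_q' (matched_move m mx my).
Qed.

Lemma phase1_cut x y : x != y -> phase1 k1 x y -> phase2 0 x y.
Proof. by move=> ne p1; exists x, y; split=> //; exists [::], [::]. Qed.

Lemma phase2_end q x y : k2 <= q -> phase2 q x y -> phase3 0 x.
Proof.
move=> le_q [z [w [ne p1 m]]]; exists x, y, [::]; split=> //.
by exists z, w; split=> //; apply: matchedW m.
Qed.

Lemma level_reach_sound c x y : level_reach c x y -> level_spec c x y.
Proof.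
elim=> {c x y} [x y ix iy|c x y a b x' y' c' _ IH _ mx my eq_ab step].
  by exists x, y; split=> //; exists [::], [::].
move: IH; rewrite /level_spec; case: (leqP c k1) => [le1|gt1].
  have lt12 : (k1 + k2 < c) = false by lia.
  rewrite lt12 orbF in eq_ab; move/eqP: eq_ab my => <- my p1.
  have stay : phase1 c x' y' by apply: phase1_move p1 mx my _; apply: leq_addr.
  case/orP: step => [/eqP->|/andP[/eqP->]]; first by rewrite le1.
  case: eqP => [eq1 ne|ne1 sa]; last first.
    have -> : c.+1 <= k1 by lia.
    by apply: phase1_move p1 mx my _; case: (a) sa => // ?; rewrite addn1.
  rewrite eq1 ltnn; rewrite eq1 in p1.
  have p2 : phase2 0 x' y'.
    exact: phase2_move (phase1_cut ne p1) mx my _.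
  (* For [k2 = 0], level [k1 + 1] already belongs to the third phase. *)
  case: ifP => [_|gt2]; first by rewrite subnn.
  have -> : k1.+1 - (k1 + k2).+1 = 0 by lia.
  by apply: phase2_end p2; lia.
have -> : (c' <= k1) = false by lia.
case: (leqP c (k1 + k2)) => [le2|gt2].
  have lt12 : (k1 + k2 < c) = false by lia.
  rewrite lt12 orbF in eq_ab; move/eqP: eq_ab my => <- my p2.
  case/orP: step => [/eqP->|/andP[/eqP->]].
    by rewrite le2; apply: phase2_move p2 mx my _; apply: leq_addr.
  have -> : (c == k1) = false by lia.
  move=> sa; have p2' : phase2 (c - k1) x' y'.
    by apply: phase2_move p2 mx my _; case: (a) sa => // ? _ /=; lia.
  (* From level [k1 + k2] this move supplies the last of the [k2] labels and enters the third
     phase. *)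
  case: ifP => [_|gt2]; first by rewrite subSS.
  have -> : c.+1 - (k1 + k2).+1 = 0 by lia.
  by apply: phase2_end p2'; lia.
have -> : (c' <= k1 + k2) = false by lia.
move=> [x1 [y1 [s [p2 rs le_s]]]]; have [r rr lr] := move_reaches mx.
exists x1, y1, (s ++ r); split=> //; first exact: reaches_cat rs rr.
rewrite labseq_cat size_cat lr; case/orP: step => [/eqP->|/andP[/eqP->]].
  by apply: leq_trans le_s _; apply: leq_addr.
have -> : (c == k1) = false by lia.
by case: (a) => // l _ /=; lia.
Qed.

Lemma mkseq_nth_take (T : Type) (t0 : T) (s : seq T) m :
  m <= size s -> mkseq (nth t0 s) m = take m s.
Proof.
move=> le_m; apply: (@eq_from_nth _ t0); first by rewrite size_mkseq size_takel.
by move=> i; rewrite size_mkseq => lti; rewrite nth_mkseq // nth_take.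
Qed.

(** The first component runs through three consecutive paths. The third reads [#|state S|] labels,
    so by [pumping] the words of the first two begin an omega-word, while their estimate contains
    both [z] and [w]. *)
Lemma level_reach_not_detectable x y :
  level_reach depth x y -> ~ omega_detectable S k1 k2.
Proof.
move=> /level_reach_sound; rewrite /level_spec /depth.
have -> : (k1 + k2 + 1 + #|state S| <= k1) = false by lia.
have -> : (k1 + k2 + 1 + #|state S| <= k1 + k2) = false by lia.
have -> : k1 + k2 + 1 + #|state S| - (k1 + k2).+1 = #|state S| by lia.
case=> x1 [y1 [s3 [[z [w [ne_zw [x0 [y0 [ix iy m1]]]]]] m2 r3 le3]]].
case: m1 m2 => s1 [s1' [r1 r1' l1 le1]] [s2 [s2' [r2 r2' l2 le2]]] det.
(* A default event for [nth]: [s3] is not empty, since it reads at least [#|state S|] labels and [x]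
   is a state. *)
have [t0 _] : exists t : event S, True.
  case: s3 le3 {r3} => [|t s3 _]; last by exists t.
  by rewrite leqNgt (cardD1 x).
have [xs [xs0 xsN xsP]] :=
  reaches_states t0 (reaches_cat (reaches_cat r1 r2) r3).
set s := (s1 ++ s2) ++ s3 in xsN xsP.
have take12 : mkseq (nth t0 s) (size (s1 ++ s2)) = s1 ++ s2.
  by rewrite mkseq_nth_take /s ?take_size_cat // (size_cat (s1 ++ s2)) leq_addr.
have take123 : mkseq (nth t0 s) (size s) = s.
  by rewrite mkseq_nth_take // take_size.
have [||sigma sL] :=
    @pumping S (nth t0 s) xs (size (s1 ++ s2)) (size s) _ xsP.
- by rewrite xs0.
- rewrite /lcount take12 take123 /s (labseq_cat (s1 ++ s2)) size_cat.
  by rewrite leq_add2l.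
rewrite take12 labseq_cat => pre.
have /eqP/cards1P[v M1] := det _ sL _ _ pre le1 le2.
have : z \in delayed_estimate (labseq s1) (labseq s2).
  by rewrite inE; apply/asboolP; exists x0, x1, s1, s2.
have : w \in delayed_estimate (labseq s1) (labseq s2).
  by rewrite inE; apply/asboolP; exists y0, y1, s1', s2'.
by rewrite M1 !inE => /eqP ew /eqP ez; rewrite ez ew eqxx in ne_zw.
Qed.

(* The levels from [c] to [c'] must avoid leaving [k1], which needs a
   disequality of states rather than a label. *)
Lemma level_reach_matched c c' x s x' y s' y' :
  reaches x s x' -> reaches y s' y' -> labseq s = labseq s' ->
  level_reach c x y -> c <= c' <= c + size (labseq s) ->
  (k1 < c) || (c' <= k1) -> c' < depth -> level_reach c' x' y'.
Proof.
(* Induction on the total length. Unobservable events come first, the other component idling; then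
   equal labels are read jointly. *)
have [n] := ubnP (size s + size s').
elim: n => // n IH in c x y s s' *.
move=> /ltnSE le_n rs rs' ls R /andP[le_c le_c'] ok lt_d.
have lt_c := leq_ltn_trans le_c lt_d.
case: s' => [|t' s'] in rs' ls le_n *; last first.
  case: rs' => y1 ty rs'; case lt': (lab t') => [l'|]; last first.
    apply: (IH c x y1 s s') => //; rewrite ?le_c //.
    - by rewrite /= in le_n; lia.
    - by rewrite ls /labseq /= lt'.
    - have := move_trans ty; rewrite lt' => my.
      by apply: LevelMove R lt_c (move_idle x) my _ _; rewrite eqxx.
  case: s => [|t s] in rs ls le_n le_c' *.
    by rewrite /labseq /= lt' in ls.
  case: rs => x1 tx rs; case lt: (lab t) => [l|]; last first.
    apply: (IH c x1 y s (t' :: s')) => //.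
    - by exists y1.
    - by rewrite -ls /labseq /= lt.
    - have := move_trans tx; rewrite lt => mx.
      by apply: LevelMove R lt_c mx (move_idle y) _ _; rewrite eqxx.
    - by move: le_c'; rewrite le_c /labseq /= lt.
  move: ls; rewrite /labseq /= lt lt' => -[eq_l ls].
  have mx : (x, Some l, x1) \in moves by rewrite -lt; apply: move_trans tx.
  have my : (y, Some l, y1) \in moves.
    by rewrite eq_l -lt'; apply: move_trans ty.
  rewrite /labseq /= lt /= -/(labseq s) in le_c'.
  (* The level rises with each label until it is [c'], and lags from then on. *)
  case: (ltngtP c c') le_c => // [lt_cc'|eq_cc'] _.
    apply: (IH c.+1 x1 y1 s s') => //.
    - by rewrite /= in le_n; lia.
    - apply: LevelMove R lt_c mx my _ _; first by rewrite eqxx.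
      have -> : (c == k1) = false by lia.
      by rewrite !eqxx orbT.
    - by rewrite lt_cc'; lia.
    - by lia.
  apply: (IH c x1 y1 s s') => //.
  - by rewrite /= in le_n; lia.
  - by apply: LevelMove R lt_c mx my _ _; rewrite eqxx.
  - by rewrite -eq_cc' leqnn leq_addr.
case: s => [|t s] in rs ls le_n le_c' *; last first.
  case: rs => x1 tx rs; case lt: (lab t) => [l|]; last first.
    apply: (IH c x1 y s [::]) => //.
    - by rewrite -ls /labseq /= lt.
    - have := move_trans tx; rewrite lt => mx.
      by apply: LevelMove R lt_c mx (move_idle y) _ _; rewrite eqxx.
    - by move: le_c'; rewrite le_c /labseq /= lt.
  by rewrite /labseq /= lt in ls.
have <- : c = c' by move: le_c'; rewrite /= addn0; lia.
by move: rs rs' => /= <- <-.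
Qed.

(** Above [k1 + k2] the labels need not agree, so the second component can idle throughout. *)
Lemma level_reach_free c x s x' y : reaches x s x' ->
  level_reach c x y -> k1 + k2 < c <= depth ->
  depth <= c + size (labseq s) -> exists x1, level_reach depth x1 y.
Proof.
elim: s => [|t s IH] /= in c x *.
  move=> _ R lt_c; rewrite addn0 => le_d; exists x.
  by have <- : c = depth by lia.
case=> x1 tx rs R /andP[lt_c le_c] le_d.
case: (ltngtP c depth) le_c => // [lt_cd|eq_cd] _; last first.
  by exists x; rewrite -eq_cd.
have mx := move_trans tx; have my := move_idle y.
case lt: (lab t) => [l|].
  apply: (IH c.+1 x1) => //; rewrite ?lt_cd ?andbT //; try lia.
    apply: LevelMove R lt_cd mx my _ _; rewrite ?lt_c ?orbT //.
    have -> : (c == k1) = false by lia.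
    by rewrite lt eqxx orbT.
  by move: le_d; rewrite /labseq /= lt /= addSnnS.
apply: (IH c x1) => //; rewrite ?lt_c ?(ltnW lt_cd) //.
  by apply: LevelMove R lt_cd mx my _ _; rewrite ?lt_c ?orbT ?eqxx.
by move: le_d; rewrite /labseq /= lt.
Qed.

(** The number of labels read is unbounded and grows by at most one per event, so every count is
    attained, in particular those of [w] and [w ++ v]. *)
Lemma labseq_prefix_positions us sigma (w v : seq (label S)) :
  omega_labseq us sigma -> prefix_of (w ++ v) sigma ->
  exists m n, [/\ m <= n, labseq (mkseq us m) = w &
    labseq [seq us i | i <- iota m (n - m)] = v].
Proof.
move=> [pre unb] pre_wv.
have pos q : exists m, lcount us m = q.
  have [N leN] := unb q.
  have [i||i _ <-] := @discrete_ivt (lcount us) N q; last by exists i.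
  - by rewrite lcountS; case: (isSome _); lia.
  - by [].
have pre_w : mkseq sigma (size w) = w.
  have := congr1 (take (size w)) pre_wv; rewrite take_size_cat // => e.
  rewrite -[RHS]e size_cat /mkseq -map_take take_iota.
  by rewrite (minn_idPl (leq_addr _ _)).
have [m cm] := pos (size w); have [n0 cn0] := pos (size (w ++ v)).
(* The two positions were chosen independently. If [n0] precedes [m], the counts force [v] to be
   empty and [m] itself serves. *)
have [n le_mn cn] : exists2 n, m <= n & lcount us n = size (w ++ v).
  case: (leqP m n0) => [|lt_nm]; first by exists n0.
  exists m => //; apply/eqP; rewrite eqn_leq {1}cm size_cat leq_addr.
  by rewrite -size_cat -cn0 (lcount_mono _ (ltnW lt_nm)).
have eq_w : labseq (mkseq us m) = w by rewrite -(pre m) -/(lcount us m) cm.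
exists m, n; split=> //.
have := pre n; rewrite /prefix_of -/(lcount us n) cn pre_wv.
by rewrite (labseq_mkseq_split us le_mn) eq_w => /(congr1 (drop (size w)));
  rewrite !drop_size_cat.
Qed.

(** The state of the given run after [w] lies in the estimate. Another member [y] comes with a path
    reading the same words, and the pair of paths climbs to [depth]. *)
Lemma not_level_reach_detectable :
  (forall x y, ~ level_reach depth x y) -> omega_detectable S k1 k2.
Proof.
move=> unreach sigma [us [xs [x0 tr olab]]] w v pre le1 le2.
have [m [n [le_mn ew ev]]] := labseq_prefix_positions olab pre.
have run N : run_upto us xs N by move=> i _; apply: tr.
have r1 : reaches (xs 0) (mkseq us m) (xs m) by apply: (run_reaches (run m)).
have r2 : reaches (xs m) [seq us i | i <- iota m (n - m)] (xs n).
  by have := @run_reaches _ us xs n m (n - m) (run n); rewrite subnKC //; apply.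
apply/eqP/cards1P; exists (xs m); apply/setP => y; rewrite !inE.
apply/asboolP/eqP => [[y0 [y' [s1 [s2 [iy l1 l2 q1 q2]]]]]|->]; last first.
  by exists (xs 0), (xs n), (mkseq us m), [seq us i | i <- iota m (n - m)].
apply: contrapT => /eqP ne_y.
have X_gt0 : 0 < #|state S| by rewrite (cardD1 y).
have R1 : level_reach k1 (xs m) y.
  apply: (level_reach_matched r1 q1) (LevelInit x0 iy) _ _ _.
  - by rewrite ew l1.
  - by rewrite ew le1.
  - by rewrite leqnn orbT.
  - by rewrite /depth; lia.
(* Both components idle: the move only certifies that the states differ. *)
have R2 : level_reach k1.+1 (xs m) y.
  apply: LevelMove R1 _ (move_idle _) (move_idle _) _ _.
  - by rewrite /depth; lia.
  - by rewrite eqxx.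
  - by rewrite !eqxx [xs m == y]eq_sym ne_y orbT.
have R3 : level_reach (k1 + k2).+1 (xs n) y'.
  apply: (level_reach_matched r2 q2) R2 _ _ _.
  - by rewrite ev l2.
  - by rewrite ev; apply/andP; split; lia.
  - by rewrite ltnSn.
  - by rewrite /depth; lia.
(* The word is infinite, so the run reads [#|state S|] further labels by some time [N]. *)
have [_ unb] := olab; have [N leN] := unb (lcount us n + #|state S|).
have le_nN : n <= N.
  rewrite leqNgt; apply/negP => lt.
  by move: (lcount_mono us (ltnW lt)) leN; rewrite -/(lcount us N); lia.
have r3 : reaches (xs n) [seq us i | i <- iota n (N - n)] (xs N).
  by have := @run_reaches _ us xs N n (N - n) (run N); rewrite subnKC //; apply.
have [|| x1 /unreach//] := level_reach_free r3 R3.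
  by rewrite /depth; lia.
move: leN; rewrite (labseq_mkseq_split us le_nN) size_cat leq_add2l.
by rewrite /depth; lia.
Qed.

End Product.

(** * The marking procedure *)

Lemma nth_flatten3 (T : Type) (x0 : T) (f : T -> nat) g h (s : seq T) i :
  i < size s ->
  let l := flatten [seq [:: f x; g x; h x] | x <- s] in
  [/\ nth 0 l (i * 3) = f (nth x0 s i), nth 0 l (i * 3 + 1) = g (nth x0 s i) &
      nth 0 l (i * 3 + 2) = h (nth x0 s i)].
Proof.
elim: s i => [|x s IH] [|i] //; rewrite ltnS => /IH.
by rewrite mulSn !addSn.
Qed.

(** Base-[n] notation with last digits [x] and [y] and an unbounded leading part [q]. *)
Definition radix2 (n q x y : nat) := (q * n + x) * n + y.

Lemma radix2_inj n c x y c' x' y' : x < n -> y < n -> x' < n -> y' < n ->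
  radix2 n c x y = radix2 n c' x' y' -> [/\ c = c', x = x' & y = y'].
Proof.
have inj q r q' r' : r < n -> r' < n -> q * n + r = q' * n + r' ->
    q = q' /\ r = r'.
  move=> ltr ltr' e; have n_gt0 : 0 < n by apply: leq_ltn_trans ltr.
  have := congr1 (divn^~ n) e; have := congr1 (modn^~ n) e.
  by rewrite /= !modnMDl !divnMDl // !modn_small // !divn_small // !addn0.
by move=> ltx lty ltx' lty' /inj[] // /inj[] // -> -> ->.
Qed.

(** Cells 0 to 6 of the input are the header written by [encode]; the offset 7 used below skips
    it. *)
Definition e_in i := EInp (EConst i).
Definition e_states := e_in 0.
Definition e_events := e_in 1.
Definition e_init := e_in 3.
Definition e_trans := e_in 4.
Definition e_k1 := e_in 5.
Definition e_k2 := e_in 6.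
Definition e_depth := EAdd (EAdd (EAdd e_k1 e_k2) (EConst 1)) e_states.

Definition e_trans_field j i :=
  EInp (EAdd (EAdd (EConst 7) e_init)
             (EAdd e_events (EAdd (EMul j (EConst 3)) (EConst i)))).
(** By truncated subtraction this is 1 if [j] is the index of a transition and 0 otherwise. *)
Definition e_is_trans j := ESub (EConst 1) (ESub (EConst 1) (ESub e_trans j)).
(** Indices from [#|trans S|] on denote idle moves. There the indicator cancels the field and the
    difference is the number of the state; on transitions the difference is 0. *)
Definition e_src j :=
  EAdd (EMul (e_trans_field j 0) (e_is_trans j)) (ESub j e_trans).
Definition e_lab j :=
  EMul (EInp (EAdd (EAdd (EConst 7) e_init) (e_trans_field j 1)))
       (e_is_trans j).
Definition e_tgt j :=
  EAdd (EMul (e_trans_field j 2) (e_is_trans j)) (ESub j e_trans).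

Definition e_neq a b := EAdd (ESub a b) (ESub b a).
Definition e_not a := ESub (EConst 1) a.

(* Cell 0 is kept for the answer. *)
Definition e_cell c x y :=
  EAdd (EMul (EAdd (EMul c e_states) x) e_states) (EAdd y (EConst 1)).

(** The side conditions of [LevelMove], with sums for disjunctions and products for conjunctions.
    Variables 1, 2 and 3 are the level and two move indices; variable 0 counts the rounds. *)
Definition relax : cmd :=
  let c := EVar 1 in let i := EVar 2 in let j := EVar 3 in
  CIf (EMark (e_cell c (e_src i) (e_src j)))
 (CIf (EAdd (e_not (e_neq (e_lab i) (e_lab j))) (ESub c (EAdd e_k1 e_k2)))
 (CSeq (CMark (e_cell c (e_tgt i) (e_tgt j)))
 (CIf (EAdd (EMul (e_lab i) (e_neq c e_k1))
            (EMul (e_neq (e_src i) (e_src j)) (e_not (e_neq c e_k1))))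
      (CMark (e_cell (EAdd c (EConst 1)) (e_tgt i) (e_tgt j)))))).

Definition mark_init : cmd :=
  CFor e_init (CFor e_init
    (CMark (e_cell (EConst 0) (EInp (EAdd (EConst 7) (EVar 0)))
                              (EInp (EAdd (EConst 7) (EVar 1)))))).

(** There are as many rounds as triples of a level up to the depth and two states, which exceeds the
    length of any path without repetitions. *)
Definition saturate : cmd :=
  CFor (EMul (EMul (EAdd e_depth (EConst 1)) e_states) e_states)
    (CFor e_depth
    (CFor (EAdd e_trans e_states) (CFor (EAdd e_trans e_states) relax))).

Definition mark_answer : cmd :=
  CFor e_states (CFor e_states
    (CIf (EMark (e_cell e_depth (EVar 0) (EVar 1))) (CMark (EConst 0)))).

Definition search : cmd := CSeq mark_init (CSeq saturate mark_answer).

(** * Correctness of the search *)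

Section Search.

Variables (S : fsa) (k1 k2 : nat).
Let inp := encode S k1 k2.
Implicit Types (x y : state S) (env : seq nat) (a : pred nat).

Definition label_code (o : option (label S)) : nat :=
  if o is Some l then (enum_rank l).+1 else 0.

Lemma label_code_inj : injective label_code.
Proof. by move=> [l|] [l'|] //= [] /val_inj/enum_rank_inj ->. Qed.

Lemma encode_tail i : nth 0 inp (7 + i) =
  nth 0 ([seq nat_of_ord (enum_rank x) | x <- enum (init S)] ++
         [seq label_code (lab t) | t <- enum (event S)] ++
         flatten [seq [:: nat_of_ord (enum_rank e.1.1);
           nat_of_ord (enum_rank e.1.2); nat_of_ord (enum_rank e.2)]
           | e <- enum (trans S)]) i.
Proof. by []. Qed.

Lemma encode_init i x0 : i < #|init S| ->
  nth 0 inp (7 + i) = enum_rank (nth x0 (enum (init S)) i).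
Proof.
move=> lt_i; rewrite encode_tail nth_cat size_map -cardE lt_i.
by rewrite (nth_map x0) // -cardE.
Qed.

Lemma encode_lab t :
  nth 0 inp (7 + #|init S| + enum_rank t) = label_code (lab t).
Proof.
rewrite -addnA encode_tail nth_cat size_map -cardE ltnNge leq_addr.
rewrite addKn nth_cat size_map -cardE ltn_ord.
by rewrite (nth_map t) ?nth_enum_rank // -cardE ltn_ord.
Qed.

Lemma encode_trans e j : j < #|trans S| -> nth e (enum (trans S)) j = e ->
  [/\ nth 0 inp (7 + #|init S| + (#|event S| + (j * 3 + 0))) = enum_rank e.1.1,
      nth 0 inp (7 + #|init S| + (#|event S| + (j * 3 + 1))) = enum_rank e.1.2 &
      nth 0 inp (7 + #|init S| + (#|event S| + (j * 3 + 2))) = enum_rank e.2].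
Proof.
move=> lt_j nth_j.
have skip k : nth 0 inp (7 + #|init S| + (#|event S| + k)) =
    nth 0 (flatten [seq [:: nat_of_ord (enum_rank e.1.1);
       nat_of_ord (enum_rank e.1.2); nat_of_ord (enum_rank e.2)]
       | e <- enum (trans S)]) k.
  rewrite -addnA encode_tail nth_cat size_map -cardE ltnNge leq_addr.
  by rewrite addKn nth_cat size_map -cardE ltnNge leq_addr addKn.
rewrite !skip addn0; have lt_j' : j < size (enum (trans S)) by rewrite -cardE.
have := nth_flatten3 e (fun e => nat_of_ord (enum_rank e.1.1))
  (fun e => nat_of_ord (enum_rank e.1.2)) (fun e => nat_of_ord (enum_rank e.2))
  lt_j'.
by rewrite nth_j.
Qed.

(** This is where the time polynomial gets its argument: values and loop limits are bounded in terms
    of the largest input number. *)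
Lemma encode_bound i : nth 0 inp i <= fsa_size S + k1 + k2.
Proof.
have lt_i0 : #|init S| <= #|state S| by apply: max_card.
have rank (T : finType) (x : T) : nat_of_ord (enum_rank x) <= #|T|.
  exact/ltnW/ltn_ord.
have [le_n le_e le_l le_t] : [/\ #|state S| <= fsa_size S + k1 + k2,
    #|event S| <= fsa_size S + k1 + k2, #|label S| <= fsa_size S + k1 + k2 &
    #|trans S| <= fsa_size S + k1 + k2].
  by rewrite /fsa_size; move: #|_| #|_| #|_| #|_| => n1 n2 n3 n4; split; lia.
have [lt_i|] := ltnP i (size inp); last by move/(nth_default 0) => ->.
suff /all_nthP -> : all (leq^~ (fsa_size S + k1 + k2)) inp by [].
rewrite /inp /encode all_cat /= le_n le_e le_l le_t leq_addl.
rewrite (leq_trans (leq_addl (fsa_size S) _) (leq_addr _ _))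
  (leq_trans lt_i0) //= !all_cat; apply/and3P; split.
- by apply/allP => _ /mapP[x _ ->]; apply: leq_trans le_n; apply: rank.
- apply/allP => _ /mapP[t _ ->]; case: (lab t) => [l|] //.
  exact: leq_trans (ltn_ord (enum_rank l)) le_l.
- apply/allP => v /flatten_mapP[[[x t] y] _]; rewrite !inE => /or3P[] /eqP-> /=.
  + exact: leq_trans (rank _ x) le_n.
  + exact: leq_trans (rank _ t) le_e.
  + exact: leq_trans (rank _ y) le_n.
Qed.

Lemma enum_rank_nth (T : finType) (x : T) i :
  i < #|T| -> nat_of_ord (enum_rank (nth x (enum T) i)) = i.
Proof.
move=> lt_i; apply/eqP.
have sz : size (enum T) = #|T| by rewrite cardE.
rewrite -(nth_uniq x _ _ (enum_uniq T)) ?sz ?ltn_ord //.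
by rewrite nth_enum_rank.
Qed.

Lemma size_moves : size (moves S) = #|trans S| + #|state S|.
Proof. by rewrite size_cat size_map size_image -cardE. Qed.

Lemma eval_move env a e x b y : eval inp env a e < size (moves S) ->
  nth (x, b, y) (moves S) (eval inp env a e) = (x, b, y) ->
  [/\ eval inp env a (e_src e) = enum_rank x,
      eval inp env a (e_lab e) = label_code b &
      eval inp env a (e_tgt e) = enum_rank y].
Proof.
rewrite size_moves; set j := eval inp env a e => lt_j.
have eval_field i : eval inp env a (e_trans_field e i) =
  nth 0 inp (7 + #|init S| + (#|event S| + (j * 3 + i))) by [].
have eval_is : eval inp env a (e_is_trans e) = (j < #|trans S|).
  by rewrite [LHS]/(1 - (1 - (#|trans S| - j))); lia.
have eval_sub : eval inp env a (ESub e e_trans) = j - #|trans S| by [].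
have eval_lab : eval inp env a (e_lab e) =
  nth 0 inp (7 + #|init S| + eval inp env a (e_trans_field e 1)) *
  eval inp env a (e_is_trans e) by [].
have eval_end i : eval inp env a
    (EAdd (EMul (e_trans_field e i) (e_is_trans e)) (ESub e e_trans)) =
  eval inp env a (e_trans_field e i) * eval inp env a (e_is_trans e) +
  (j - #|trans S|) by [].
rewrite eval_lab !eval_end eval_is !eval_field nth_cat size_map -cardE.
case: ltnP => [lt_t|le_t]; last rewrite [nat_of_bool _]/=.
  have [u _] : exists u, u \in trans S 
    by apply/set0Pn; rewrite -card_gt0 (leq_ltn_trans (leq0n j)).
  rewrite (nth_map u) -?cardE //.
  have := @encode_trans (nth u (enum (trans S)) j) j lt_t.
  rewrite (set_nth_default u) -?cardE // => /(_ erefl).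
  case: (nth u _ j) => -[x1 t] y1 [-> -> ->] [<- <- <-].
  have /eqP-> : j - #|trans S| == 0 by rewrite subn_eq0 ltnW.
  by rewrite !addn0 !muln1 encode_lab.
have lt_x : j - #|trans S| < #|state S|.
  by rewrite -(ltn_add2l #|trans S|) subnKC.
rewrite !muln0 !add0n (nth_map x) -?cardE // => -[eq_x <- eq_y].
by have := enum_rank_nth x lt_x; rewrite -eq_y eq_x => ->.
Qed.

Definition cell (c : nat) x y : nat :=
  (radix2 #|state S| c (enum_rank x) (enum_rank y)).+1.

Lemma cell_inj c x y c' x' y' :
  cell c x y = cell c' x' y' -> [/\ c = c', x = x' & y = y'].
Proof.
case=> /radix2_inj[] // -> /val_inj/enum_rank_inj-> /val_inj/enum_rank_inj->.
by [].
Qed.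

Lemma eval_cell env a e e1 e2 c x y : eval inp env a e = c ->
  eval inp env a e1 = enum_rank x -> eval inp env a e2 = enum_rank y ->
  eval inp env a (e_cell e e1 e2) = cell c x y.
Proof. by rewrite /cell => <- <- <-; rewrite -addn1 -addnA. Qed.

Lemma exec_markE env e a v :
  exec inp env (CMark e) a v = (v == eval inp env a e) || a v.
Proof. by []. Qed.

Lemma eval_neq env a e1 e2 :
  (eval inp env a (e_neq e1 e2) == 0) =
  (eval inp env a e1 == eval inp env a e2).
Proof. by rewrite /=; lia. Qed.

(** After the first test nothing reads the marks, so the two markings do not interfere and the
    conditions of [LevelMove] come out literally. *)
Lemma exec_relax a r c i j x1 b1 y1 x2 b2 y2 v :
  let m := moves S in i < size m -> j < size m ->
  nth (x1, b1, y1) m i = (x1, b1, y1) -> nth (x2, b2, y2) m j = (x2, b2, y2) ->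
  exec inp [:: r; c; i; j] relax a v =
    [&& a (cell c x1 x2), (b1 == b2) || (k1 + k2 < c) &
      (v == cell c y1 y2) || (v == cell c.+1 y1 y2) &&
        (if c == k1 then x1 != x2 else b1 != None)] || a v.
Proof.
move=> m lt_i lt_j mi mj; set env := [:: r; c; i; j].
have E1 a' := @eval_move env a' (EVar 2) _ _ _ lt_i mi.
have E2 a' := @eval_move env a' (EVar 3) _ _ _ lt_j mj.
have exec_if e c1 a' : exec inp env (CIf e c1) a' v =
  if eval inp env a' e == 0 then a' v else exec inp env c1 a' v.
  by rewrite /=; case: ifP.
have exec_seq p q a' : exec inp env (CSeq p q) a' =
  exec inp env q (exec inp env p a') by [].
have eval_mark e a' : eval inp env a' (EMark e) = a' (eval inp env a' e) by [].
have lab_neq a' :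
    (eval inp env a' (e_neq (e_lab (EVar 2)) (e_lab (EVar 3))) == 0)
    = (b1 == b2).
  rewrite eval_neq; have [_ -> _] := E1 a'; have [_ -> _] := E2 a'.
  exact: inj_eq label_code_inj _ _.
have src_neq a' :
    (eval inp env a' (e_neq (e_src (EVar 2)) (e_src (EVar 3))) == 0)
    = (x1 == x2).
  rewrite eval_neq; have [-> _ _] := E1 a'; have [-> _ _] := E2 a'.
  by rewrite (inj_eq val_inj) (inj_eq enum_rank_inj).
have level_neq a' : (eval inp env a' (e_neq (EVar 1) e_k1) == 0) = (c == k1).
  exact: eval_neq.
have eval_add e e' a' : (eval inp env a' (EAdd e e') == 0) =
  (eval inp env a' e == 0) && (eval inp env a' e' == 0) by exact: addn_eq0.
have eval_mul e e' a' : (eval inp env a' (EMul e e') == 0) =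
  (eval inp env a' e == 0) || (eval inp env a' e' == 0) by exact: muln_eq0.
have eval_not e a' :
    (eval inp env a' (e_not e) == 0) = (eval inp env a' e != 0).
  by rewrite -lt0n; exact: subn_eq0.
have level_sub a' : (eval inp env a' (ESub (EVar 1) (EAdd e_k1 e_k2)) == 0) =
  (c <= k1 + k2) by exact: subn_eq0.
have lab0 a' : (eval inp env a' (e_lab (EVar 2)) == 0) = (b1 == None).
  by have [_ -> _] := E1 a'; case: (b1).
have src_cell :
    eval inp env a (e_cell (EVar 1) (e_src (EVar 2)) (e_src (EVar 3)))
    = cell c x1 x2.
  by have [[? _ _] [? _ _]] := (E1 a, E2 a); apply: eval_cell.
have tgt_cell a' e c' : eval inp env a' e = c' ->
    eval inp env a' (e_cell e (e_tgt (EVar 2)) (e_tgt (EVar 3)))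
    = cell c' y1 y2.
  by have [[_ _ ?] [_ _ ?]] := (E1 a', E2 a') => ?; apply: eval_cell.
rewrite /relax exec_if eval_mark src_cell; case: (a _) => //.
rewrite exec_if eval_add eval_not lab_neq level_sub leqNgt -negb_or.
case: (_ || _); last by [].
rewrite exec_seq exec_if eval_add [X in X && _]eval_mul [X in _ && X]eval_mul.
rewrite eval_not level_neq lab0 src_neq !exec_markE.
rewrite (tgt_cell _ (EVar 1) c) // (tgt_cell _ (EAdd _ _) c.+1);
  last exact: addn1.
by case: (c == k1); case: (b1 == None); case: (x1 == x2);
  case: (v == cell c y1 y2); case: (v == cell c.+1 y1 y2).
Qed.

Definition reachable_cell v : Prop :=
  exists c x y, level_reach k1 k2 c x y /\ v = cell c x y.

Lemma mark_init_sound v : exec inp [::] mark_init pred0 v -> reachable_cell v.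
Proof.
apply: exec_for_sound v => // i a lt_i aR.
apply: exec_for_sound => // j a' lt_j a'R v.
rewrite exec_markE => /orP[/eqP->|/a'R //].
have /set0Pn[x0 _] : init S != set0.
  by rewrite -card_gt0 (leq_ltn_trans _ lt_i).
exists 0, (nth x0 (enum (init S)) i), (nth x0 (enum (init S)) j); split.
  by apply: LevelInit; rewrite -mem_enum mem_nth // -cardE.
by apply: eval_cell => //; apply: encode_init.
Qed.

Lemma mark_init_hit x y : x \in init S -> y \in init S ->
  exec inp [::] mark_init pred0 (cell 0 x y).
Proof.
have index_lt z : z \in init S -> index z (enum (init S)) < #|init S|.
  by rewrite cardE index_mem mem_enum.
move=> ix iy; apply: (@exec_for_hit _ _ _ _ _ (index x (enum (init S)))) =>
  [|a' _]; first exact: index_lt.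
apply: (@exec_for_hit _ _ _ _ _ (index y (enum (init S)))) =>
  [|a'' _]; first exact: index_lt.
rewrite exec_markE; apply/orP; left; apply/eqP.
have rank z : z \in init S ->
    nat_of_ord (enum_rank z) = nth 0 inp (7 + index z (enum (init S))).
  by move=> iz; rewrite (encode_init z (index_lt z iz)) nth_index // mem_enum.
by apply/esym/eval_cell => //; rewrite rank.
Qed.

Lemma saturate_sound a : (forall v, a v -> reachable_cell v) ->
  forall v, exec inp [::] saturate a v -> reachable_cell v.
Proof.
have size_m : size (moves S) = #|trans S| + #|state S| by apply: size_moves.
apply: exec_for_sound => r a1 _; apply: exec_for_sound => c a2 lt_c.
apply: exec_for_sound => i a3 lt_i; apply: exec_for_sound => j a4 lt_j a4R v.
have lt_i' : i < size (moves S) by rewrite size_m.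
have lt_j' : j < size (moves S) by rewrite size_m.
have m0 : state S * option (label S) * state S.
  by case: (moves S) lt_i' => // m.
case mi: (nth m0 (moves S) i) => [[x1 b1] y1].
case mj: (nth m0 (moves S) j) => [[x2 b2] y2].
rewrite (set_nth_default (x1, b1, y1)) // in mi.
rewrite (set_nth_default (x2, b2, y2)) // in mj.
rewrite (exec_relax _ _ _ _ lt_i' lt_j' mi mj) => /orP[/and3P[]|/a4R //].
move=> /a4R[c' [x [y [reach_xy /cell_inj[eq_c eq_x eq_y]]]]] eq_b marked.
subst c' x y.
have move1 : (x1, b1, y1) \in moves S by rewrite -mi mem_nth.
have move2 : (x2, b2, y2) \in moves S by rewrite -mj mem_nth.
have lt_cd : c < depth S k1 k2 by [].
case/orP: marked => [/eqP->|/andP[/eqP-> ok]].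
  exists c, y1, y2; split=> //.
  by apply: LevelMove reach_xy lt_cd move1 move2 eq_b _; rewrite eqxx.
exists c.+1, y1, y2; split=> //.
by apply: LevelMove reach_xy lt_cd move1 move2 eq_b _; rewrite eqxx ok orbT.
Qed.

Lemma level_reach_le c x y : level_reach k1 k2 c x y -> c <= depth S k1 k2.
Proof.
elim=> // c1 x1 y1 a b x2 y2 c2 _ le_c lt_c _ _ _.
by case/orP=> [/eqP->|/andP[/eqP-> _]].
Qed.

(** One round carries out any given move: [exec_for_hit] selects its level and the indices of its
    two components. *)
Lemma relax_hit r c x y b1 x' b2 y' c' a a' :
  c < depth S k1 k2 -> (x, b1, x') \in moves S -> (y, b2, y') \in moves S ->
  (b1 == b2) || (k1 + k2 < c) ->
  (c' == c) || (c' == c.+1) && (if c == k1 then x != y else b1 != None) ->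
  a (cell c x y) -> (forall v, a v -> a' v) ->
  exec inp [:: r] (CFor e_depth (CFor (EAdd e_trans e_states)
    (CFor (EAdd e_trans e_states) relax))) a' (cell c' x' y').
Proof.
move=> lt_c mx my eq_b step ac aa'.
have size_m : size (moves S) = #|trans S| + #|state S| by apply: size_moves.
have index_lt m : m \in moves S -> index m (moves S) < #|trans S| + #|state S|.
  by rewrite -size_m index_mem.
apply: (@exec_for_hit _ _ _ _ _ c) => [|a1 sub1]; first exact: lt_c.
apply: (@exec_for_hit _ _ _ _ _ (index (x, b1, x') (moves S))) => [|a2 sub2].
  exact: index_lt.
apply: (@exec_for_hit _ _ _ _ _ (index (y, b2, y') (moves S))) => [|a3 sub3].
  exact: index_lt.
rewrite (@exec_relax _ _ _ _ _ x b1 x' y b2 y') ?index_mem ?nth_index //.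
have -> : a3 (cell c x y) by apply/sub3/sub2/sub1/aa'.
rewrite eq_b /=.
by case/orP: step => [/eqP->|/andP[/eqP-> ->]]; rewrite eqxx ?orbT.
Qed.

Lemma saturate_hit a c x y :
  (forall x0 y0, x0 \in init S -> y0 \in init S -> a (cell 0 x0 y0)) ->
  level_reach k1 k2 c x y -> exec inp [::] saturate a (cell c x y).
Proof.
move=> a_init reach_xy.
(* Levels never exceed the depth, so reachability takes place in a finite graph. *)
pose T := ('I_(depth S k1 k2).+1 * state S * state S)%type.
pose step (u v : T) := `[< exists b1 b2,
  [/\ u.1.1 < depth S k1 k2, (u.1.2, b1, v.1.2) \in moves S,
      (u.2, b2, v.2) \in moves S, (b1 == b2) || (k1 + k2 < u.1.1) &
      (v.1.1 == u.1.1 :> nat) || (v.1.1 == u.1.1.+1 :> nat) &&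
      (if u.1.1 == k1 :> nat then u.1.2 != u.2 else b1 != None)] >].
pose f (u : T) := cell u.1.1 u.1.2 u.2.
have inordE c1 x1 y1 : level_reach k1 k2 c1 x1 y1 ->
    nat_of_ord (inord c1 : 'I_(depth S k1 k2).+1) = c1.
  by move=> /level_reach_le le_c; rewrite inordK.
have [x0 [y0 [ix0 iy0 conn]]] : exists x0 y0, [/\ x0 \in init S, y0 \in init S &
    connect step (inord 0, x0, y0) (inord c, x, y)].
  elim: {c x y} reach_xy
    => [x y ix iy|c x y b1 b2 x' y' c' R [x0 [y0 [ix iy conn]]]].
    by exists x, y.
  move=> lt_c mx my eq_b stp; exists x0, y0; split=> //.
  apply: connect_trans conn (connect1 _); apply/asboolP; exists b1, b2 => /=.
  have R' := LevelMove R lt_c mx my eq_b stp.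
  by rewrite (inordE _ _ _ R) (inordE _ _ _ R').
rewrite -(inordE _ _ _ reach_xy) -[cell _ _ _]/(f (inord c, x, y)).
apply: (exec_for_connect _ _ conn).
(* The number of rounds is exactly the number of nodes. *)
- by rewrite !card_prod card_ord -addn1.
- move=> r a' u v /asboolP[b1 [b2 [lt_c mx my eq_b stp]]] au.
  exact: relax_hit lt_c mx my eq_b stp au _.
- by rewrite /f /= inordK //; apply: a_init.
Qed.

Lemma exec_if_mark env e c a v : exec inp env (CIf (EMark e) c) a v =
  if a (eval inp env a e) then exec inp env c a v else a v.
Proof. by rewrite /=; case: (a _). Qed.

Lemma mark_answer_sound a : exec inp [::] mark_answer a 0 ->
  a 0 \/ exists x y, a (cell (depth S k1 k2) x y).
Proof.
(* The last phase can only add mark 0, so the invariant keeps all other marks as they were. *)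
pose R v := if v is 0 then a 0 \/ exists x y, a (cell (depth S k1 k2) x y)
            else (a v : Prop).
suff : forall v, exec inp [::] mark_answer a v -> R v by apply.
apply: exec_for_sound; last by case=> [|v] av //; left.
move=> i a1 lt_i a1R; apply: exec_for_sound => // j a2 lt_j a2R v.
pose x := enum_val (Ordinal lt_i : 'I_#|state S|).
pose y := enum_val (Ordinal lt_j : 'I_#|state S|).
rewrite exec_if_mark (@eval_cell _ _ _ _ _ (depth S k1 k2) x y);
  rewrite ?enum_valK //.
case: ifP => [/a2R a_xy|_]; last exact: a2R.
rewrite exec_markE => /orP[/eqP->|/a2R //].
by right; exists x, y.
Qed.

Lemma mark_answer_hit a x y : a (cell (depth S k1 k2) x y) ->
  exec inp [::] mark_answer a 0.
Proof.
move=> axy.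
apply: (@exec_for_hit _ _ _ _ _ (enum_rank x)) => [|a1 sub1].
  exact: ltn_ord.
apply: (@exec_for_hit _ _ _ _ _ (enum_rank y)) => [|a2 sub2].
  exact: ltn_ord.
by rewrite exec_if_mark (@eval_cell _ _ _ _ _ (depth S k1 k2) x y) //
  sub2 // sub1.
Qed.

Lemma search_correct : exec inp [::] search pred0 0 <->
  exists x y, level_reach k1 k2 (depth S k1 k2) x y.
Proof.
have sound := saturate_sound mark_init_sound.
(* Mark 0 cannot stem from the earlier phases, since every [cell] is a successor. *)
split=> [/mark_answer_sound[/sound[c [x [y [_ //]]]]|]|[x [y R]]].
  case=> x [y /sound[c [x' [y' [R /cell_inj[e _ _]]]]]].
  by exists x', y'; rewrite e.
apply: (@mark_answer_hit _ x y); apply: saturate_hit R => *.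
exact: mark_init_hit.
Qed.

End Search.

Theorem theorem3 :
  exists (P : program) (p : {poly nat}),
    forall (S : fsa) (k1 k2 : nat),
      exists b : bool,
        answers_within P (encode S k1 k2)
          (p.[(fsa_size S + k1 + k2)%N])%R b
        /\ (b <-> omega_detectable S k1 k2).
Proof.
exists (decider search (EMark (EConst 0))).
exists (decider_time search (EMark (EConst 0))).
move=> S k1 k2; set inp := encode S k1 k2.
(* Mark 0 signals a violation, so the answer is [true] when it is unset. *)
exists (eval inp [::] (exec inp [::] search pred0) (EMark (EConst 0)) == 0).
split.
  by apply: decider_correct => //; apply: encode_bound.
have [sound complete] := search_correct S k1 k2.
rewrite [eval _ _ _ _]/=; split=> [|det].
  rewrite eqb0 => /negP not_marked; apply: not_level_reach_detectable => x y R.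
  by apply/not_marked/complete; exists x, y.
by rewrite eqb0; apply/negP => /sound[x [y /level_reach_not_detectable]]; apply.
Qed.
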